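(* There is an absolute constant $C>0$ such that the following holds. Let $p$ be a prime, let $k,\ell,m$ be pairwise distinct positive integers, let $a,b,c\in\mathbb{F}_p^*$, let $$ \Psi(X)=aX^k+bX^\ell+cX^m\in\mathbb{F}_p[X], $$ and let $\chi$ be an arbitrary multiplicative character of $\mathbb{F}_p^*$. Define $$ d=\gcd(k,p-1),\qquad e=\gcd(\ell,p-1),\qquad f=\gcd(m,p-1), $$ $$ g=\frac{d}{\gcd(d,f)},\qquad h=\frac{e}{\gcd(e,f)}. $$ Suppose $f\ge g\ge h$. Then $$ |S_\chi(\Psi)|\le C\cdot \begin{cases} p^{7/8}f^{1/8}, & \text{if } h\ge(p\log p)^{1/2},\\ p^{15/16}(f/h)^{1/8}(\log p)^{1/16}, & \text{if } g\ge(p\log p)^{1/2}>h,\\ p\,(f/(gh))^{1/8}(\log p)^{1/8}, & \text{if } g<(p\log p)^{1/2}. \end{cases} $$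
   Context: $\mathbb{F}_p$ is the finite field with $p$ elements. For $u\in\mathbb{F}_p$, $\mathbf{e}_p(u)=\exp(2\pi i u/p)$. For a polynomial $\Psi\in\mathbb{F}_p[X]$ and a multiplicative character $\chi$ of $\mathbb{F}_p^*$, $$ S_\chi(\Psi)=\sum_{x\in\mathbb{F}_p^*}\chi(x)\,\mathbf{e}_p(\Psi(x)). $$ $\log$ is the natural logarithm. *)

(* Defs.v *)
From HB Require Import structures.
From mathcomp Require Import all_boot all_order all_algebra all_fingroup.
From mathcomp Require Import complex.
From mathcomp Require Import boolp classical_sets reals exp trigo.

Set Implicit Arguments.
Unset Strict Implicit.
Unset Printing Implicit Defensive.

Import Order.TTheory GRing.Theory Num.Theory.

Local Open Scope ring_scope.
Local Open Scope complex_scope.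

Definition expi (R : realType) (t : R) : R[i] := cos t +i* sin t.

(* The coercion 'F_p >-> nat picks the representative of u in {0, .., p-1};
   by 2pi-periodicity the value does not depend on this choice. *)
Definition e_p (R : realType) (p : nat) (u : 'F_p) : R[i] :=
  expi (2 * pi * (u : nat)%:R / p%:R : R).

Definition mult_char (R : realType) (p : nat) (chi : {unit 'F_p} -> R[i]) :
    Prop :=
  chi 1%g = 1 /\ forall x y : {unit 'F_p}, chi (x * y)%g = chi x * chi y.

Definition char_sum (R : realType) (p : nat) (chi : {unit 'F_p} -> R[i])
    (Psi : {poly 'F_p}) : R[i] :=
  \sum_(x : {unit 'F_p}) chi x * e_p R Psi.[val x].

(* Main.v *)
Require Import Defs.
From mathcomp Require Import all_boot all_order all_algebra all_fingroup.
From mathcomp Require Import cyclic.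
From mathcomp Require Import complex.
From mathcomp Require Import boolp classical_sets reals exp trigo.
From mathcomp Require Import zify ring lra.

Import Order.TTheory GRing.Theory Num.Theory.

Local Open Scope ring_scope.

(** Why the bound holds.

    Since g f = lcm(d, f) divides p - 1, the inequality g <= f forces
    g^2 < p, and p - 1 < p ln p then gives g < (p ln p)^(1/2): among the three
    ranges only the last one occurs.  There one has to show
    |S|^8 << p^8 (f / (g h)) ln p.

    Exponential sums ([trinomial_sum_pow8_le]).  Let D and E be the subgroups
    of orders d and e of the cyclic group of units.  Replacing x by x y z with
    y in D and z in E leaves S unchanged; the term in x^k does not depend on y,
    nor the term in x^l on z.  Averaging over D and E thus turns S into a
    trilinear sum with kernel psi(c (x y z)^m), psi being the additive
    character, and with weights that each involve only two of the three
    variables.  Two applications of the Cauchy-Schwarz inequality remove the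
    weights and leave the power sums Phi((1 - u)(1 - v)), where Phi(s) is the
    sum of psi(c x^m s) over the units x, u runs over the g-th roots of unity
    and v over the h-th ones.  The terms with u = 1 or v = 1 are bounded
    trivially.  For the others, a last Cauchy-Schwarz inequality over the value
    s = (1 - u)(1 - v) separates the second moment of Phi, at most p^2 f, from
    the number of solutions of (1 - u)(1 - v) = (1 - u')(1 - v').

    Multiplicative energy ([shifted_energy_bound]).  Writing rho for the common
    ratio (1 - u)/(1 - u') = (1 - v')/(1 - v), that number is a sum over rho of
    products of two counts, and it suffices to bound, for a single t with
    t^2 <= p, the sum over rho of the squared number of pairs (u, u') of
    nontrivial t-th roots of unity with 1 - u = rho (1 - u').  For rho other
    than 0 and 1, such pairs inject into the points y <> rho of the fibre
    through rho of the map x |-> (x^t, (1 - x)^t) ([card_slopes_le_fiber]).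

    Fibres ([card_rich]).  Stepanov's method ([stepanov]) bounds a set S of
    points in terms of the number of fibres that it meets: a polynomial
    in X, X^t and (1 - X)^t is made to vanish to a high order on S.  It yields
    that at most C t^2 / k^2 points lie on fibres of size at least k.  Summing
    over k costs a harmonic sum, hence the factor ln p. *)

(** * Sparse polynomials and multiplicities *)

Lemma poly_split0 (F : nzRingType) (P : {poly F}) :
  {Q : {poly F} | P = Q * 'X + (P`_0)%:P & forall i, Q`_i = P`_i.+1}.
Proof.
have cQ i : (\poly_(j < size P) P`_j.+1)`_i = P`_i.+1.
  rewrite coef_poly; case: ltnP => // le_Pi.
  by rewrite nth_default // ltnW // ltnS.
exists (\poly_(j < size P) P`_j.+1) => //.
by apply/polyP => -[|i]; rewrite coefD coefMX coefC /= ?add0r // addr0 cQ.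
Qed.

Definition nterms (F : nzRingType) (n : nat) (P : {poly F}) : nat :=
  (\sum_(i < n) (P`_i != 0)%R)%N.

(** By induction on the degree: either the constant term vanishes and a factor X
    can be removed, or differentiation kills the constant term and lowers the
    multiplicity of a by at most one.  No other term is lost, since no exponent
    strictly between 0 and p vanishes in F. *)
Lemma sparse_root_eq0 (F : fieldType) (p : nat) (charF : p \in [pchar F])
    (P : {poly F}) (a : F) :
  a != 0 -> (size P <= p)%N ->
  ('X - a%:P) ^+ nterms F p P %| P -> P = 0.
Proof.
move=> a0; have p_gt0 := prime_gt0 (pcharf_prime charF).
have [n] := ubnP (size P); elim: n P => // n IHn P /ltnSE szPn szPp.
have [Q defP cQ] := poly_split0 F P.
case: p charF p_gt0 IHn szPp => // p charF _ IHn szPp.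
have Pp : P`_p.+1 = 0 by rewrite nth_default.
have [->//|Pn0] := eqVneq P 0.
have szP : (0 < size P)%N by rewrite size_poly_gt0.
have [P0|P0] := eqVneq P`_0 0.
  rewrite P0 addr0 in defP.
  have Qn0 : Q != 0 by apply: contraNneq Pn0 => Q0; rewrite defP Q0 mul0r.
  have szQ : size P = (size Q).+1 by rewrite defP size_mulX.
  rewrite {2}defP Gauss_dvdpl; last first.
    by rewrite coprimep_expl // coprimep_sym coprimep_XsubC rootX.
  have -> : nterms F p.+1 P = nterms F p.+1 Q.
    rewrite /nterms big_ord_recl P0 eqxx add0n.
    rewrite [RHS]big_ord_recr /= cQ Pp eqxx addn0.
    by apply: eq_bigr => i _; rewrite cQ.
  have szQn : (size Q < n)%N by rewrite szQ in szPn.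
  have szQp : (size Q <= p.+1)%N by rewrite szQ in szPp; apply: ltnW.
  by move=> dvdQ; rewrite defP (IHn Q) ?mul0r.
rewrite /nterms big_ord_recl P0 => dvdP.
have dP0 : P^`() = 0.
  apply: IHn; first by apply: leq_trans (lt_size_deriv Pn0) _.
    by apply: leq_trans (ltnW (lt_size_deriv Pn0)) _.
  have -> : nterms F p.+1 P^`() = (\sum_(i < p) (P`_(lift ord0 i) != 0)%R)%N.
    rewrite /nterms big_ord_recr /= coef_deriv Pp mul0rn eqxx addn0.
    apply: eq_bigr => i _; rewrite coef_deriv -mulr_natr mulf_eq0 negb_or.
    rewrite -(dvdn_pcharf charF) gtnNdvd ?andbT //.
    by rewrite ltnS ltn_ord.
  move: dvdP; move: (\sum_(i < p) _)%N => w /dvdpP[Q1 ->].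
  rewrite add1n derivM dvdp_add //.
    by rewrite exprS mulrA dvdp_mull.
  by rewrite deriv_exp derivXsubC mul1r /= -mulr_natr mulrA dvdp_mulr ?dvdp_mull.
have Pc : P = (P`_0)%:P.
  apply/polyP => -[|i]; rewrite coefC //=.
  have [ltip|leip] := ltnP i p; last first.
    by rewrite nth_default // (leq_trans szPp).
  have /eqP := congr1 (fun R : {poly F} => R`_i) dP0.
  rewrite coef0 coef_deriv -mulr_natr mulf_eq0 -(dvdn_pcharf charF).
  by rewrite gtnNdvd // orbF => /eqP.
have := dvdp_leq Pn0 dvdP.
by rewrite size_exp_XsubC {2}Pc size_polyC P0 add1n.
Qed.

(** Powers of (1 - X)^t are linearly independent over the sparse polynomials:
    in a vanishing combination the coefficient of the lowest power is divisible
    by (1 - X)^t, too high a power for its number of terms. *)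
Lemma sparse_independent (F : fieldType) (p : nat) (charF : p \in [pchar F])
    (t K : nat) (P : 'I_K -> {poly F}) :
  (forall k, (size (P k) <= p)%N) ->
  (forall k, (nterms F p (P k) <= t)%N) ->
  \sum_(k < K) P k * (1 - 'X) ^+ (t * k) = 0 ->
  forall k, P k = 0.
Proof.
elim: K P => [P _ _ _ []//|K IHK P szP ntP].
rewrite big_ord_recl muln0 expr0 mulr1.
have -> : \sum_(i < K) P (lift ord0 i) * (1 - 'X) ^+ (t * lift ord0 i)
    = (\sum_(i < K) P (lift ord0 i) * (1 - 'X) ^+ (t * i)) * (1 - 'X) ^+ t.
  rewrite mulr_suml; apply: eq_bigr => i _.
  by rewrite -mulrA -exprD lift0 mulnS [in RHS]addnC.
move=> sum0.
have P0 : P ord0 = 0.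
  apply: (sparse_root_eq0 F p charF _ 1 (oner_neq0 F)) => //.
  apply: dvdp_trans (dvdp_exp2l _ (ntP ord0)) _.
  rewrite -dvdpNr (addr0_eq sum0) -[X in _ * X ^+ _]opprB polyC1 exprNn mulrA.
  exact: dvdp_mull.
move: sum0; rewrite P0 add0r => /eqP; rewrite mulf_eq0 expf_eq0.
rewrite -opprB oppr_eq0 -polyC1 polyXsubC_eq0 andbF orbF => /eqP sum0 k.
rewrite polyC1 opprB in sum0.
by case: (unliftP ord0 k) => [k' ->|->//]; apply: (IHK (P \o lift ord0)) => /=.
Qed.

(** If a had exact multiplicity j + 1 <= n in P, its multiplicity in the
    derivative would be exactly j < n, because j + 1 < p is nonzero in F. *)
Lemma dvdp_exp_deriv (F : fieldType) (p : nat) (charF : p \in [pchar F])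
    (P : {poly F}) (a : F) (n : nat) :
  (n < p)%N -> root P a -> ('X - a%:P) ^+ n %| P^`() ->
  ('X - a%:P) ^+ n.+1 %| P.
Proof.
move=> ltnp Pa dvdP'.
have [->|Pn0] := eqVneq P 0; first exact: dvdp0.
(* j is the exact multiplicity of a in P *)
have [j [Q]] := multiplicity_XsubC P a.
rewrite Pn0 /= => Qa defP.
have [ltnj|lejn] := ltnP n j; first by rewrite defP dvdp_mull // dvdp_exp2l.
case: j lejn defP => [|j] lejn defP.
  by rewrite defP expr0 mulr1 (negPf Qa) in Pa.
have : ('X - a%:P) ^+ j.+1 %| P^`() by apply: dvdp_trans dvdP'; rewrite dvdp_exp2l.
have -> : P^`() = (Q^`() * ('X - a%:P) + Q * j.+1%:R) * ('X - a%:P) ^+ j.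
  rewrite defP derivM deriv_exp derivXsubC mul1r /= exprS -mulr_natr.
  by rewrite [RHS]mulrDl -!mulrA [_%:R * _]mulrC.
rewrite exprS dvdp_mul2r ?expf_neq0 ?polyXsubC_eq0 //.
rewrite dvdp_addr; last exact: dvdp_mull.
rewrite dvdp_XsubCl rootM (negPf Qa) /=.
rewrite -polyC_natr rootC -(dvdn_pcharf charF) gtnNdvd //.
exact: leq_ltn_trans lejn ltnp.
Qed.

(** A derivation which, contrary to d/dX, maps P X^u (1 - X)^v to a polynomial
    of the same shape with the same exponents u and v; away from 0 and 1 it
    detects multiplicities as well as d/dX does. *)
Definition eulerd (F : fieldType) (P : {poly F}) : {poly F} :=
  'X * (1 - 'X) * P^`().

Lemma dvdp_exp_eulerd (F : fieldType) (p : nat) (charF : p \in [pchar F])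
    (P : {poly F}) (a : F) (n : nat) :
  (n <= p)%N -> a != 0 -> a != 1 ->
  (forall r, (r < n)%N -> root (iter r (@eulerd F) P) a) ->
  ('X - a%:P) ^+ n %| P.
Proof.
move=> lenp a0 a1; elim: n P lenp => [|n IHn] P ltnp rootP.
  by rewrite expr0 dvd1p.
apply: (dvdp_exp_deriv F p charF) => //; first exact: (rootP 0%N).
have : ('X - a%:P) ^+ n %| eulerd F P.
  apply: IHn; first exact: ltnW.
  by move=> r ltrn; rewrite -iterSr; apply: rootP.
rewrite /eulerd Gauss_dvdpr // coprimep_expl // coprimep_sym coprimep_XsubC.
rewrite rootM rootX.
by rewrite negb_or a0 /root !hornerE subr_eq0 eq_sym.
Qed.

(** The polynomial cofactor of X^u (1 - X)^v in the r-th iterate of [eulerd] on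
    X^i X^u (1 - X)^v. *)
Fixpoint twist (F : fieldType) (u v i r : nat) : {poly F} :=
  if r is r'.+1 then
    'X * (1 - 'X) * (twist F u v i r')^`() +
    (u%:R * (1 - 'X) - v%:R * 'X) * twist F u v i r'
  else 'X^i.

Lemma iter_eulerd_monomial (F : fieldType) (u v i r : nat) :
  iter r (@eulerd F) ('X^i * 'X^u * (1 - 'X) ^+ v) =
  twist F u v i r * 'X^u * (1 - 'X) ^+ v.
Proof.
elim: r => // r IHr; rewrite iterS IHr /eulerd /=.
set q := twist _ _ _ _ _.
have dX n : 'X * ('X^n)^`() = n%:R * 'X^n :> {poly F}.
  case: n => [|n]; first by rewrite derivXn mulr0n mulr0 mul0r.
  by rewrite derivXn -mulr_natl mulrCA -exprS.
have d1X n : (1 - 'X) * ((1 - 'X) ^+ n)^`() = - n%:R * (1 - 'X) ^+ n :> {poly F}.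
  rewrite deriv_exp derivB derivX -polyC1 derivC sub0r polyC1.
  case: n => [|n]; first by rewrite !mulr0n mulr0 oppr0 mul0r.
  by rewrite mulN1r -mulr_natl [in RHS]exprS /=; ring.
rewrite !derivM.
transitivity ('X * (1 - 'X) * q^`() * 'X^u * (1 - 'X) ^+ v
  + q * (1 - 'X) * (1 - 'X) ^+ v * ('X * ('X^u)^`())
  + q * 'X * 'X^u * ((1 - 'X) * ((1 - 'X) ^+ v)^`())); first by ring.
by rewrite dX d1X; ring.
Qed.

(** Each iteration raises the degree by at most one, whatever u and v are; this
    is what keeps the number of linear conditions in Stepanov's method small. *)
Lemma size_twist (F : fieldType) (u v i r : nat) :
  (size (twist F u v i r) <= i + r.+1)%N.
Proof.
have sz1X : (size (1 - 'X : {poly F})%R <= 2)%N.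
  by rewrite -opprB size_polyN -polyC1 size_XsubC.
elim: r => [|r IHr] /=; first by rewrite size_polyXn addn1.
apply: leq_trans (size_polyD _ _) _; rewrite geq_max; apply/andP; split.
  apply: leq_trans (size_polyMleq _ _) _.
  have szD : (size ((twist F u v i r)^`()) <= i + r)%N.
    have [->|q0] := eqVneq (twist F u v i r) 0.
      by rewrite deriv0 size_poly0.
    by have := leq_trans (lt_size_deriv q0) IHr; lia.
  have : (size ('X * (1 - 'X) : {poly F})%R <= 3)%N.
    apply: leq_trans (size_polyMleq _ _) _; rewrite size_polyX; lia.
  lia.
apply: leq_trans (size_polyMleq _ _) _.
have : (size (u%:R * (1 - 'X) - v%:R * 'X : {poly F})%R <= 2)%N.
  apply: leq_trans (size_polyD _ _) _; rewrite geq_max size_polyN.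
  rewrite -!polyC_natr !mul_polyC.
  by rewrite !(leq_trans (size_scale_leq _ _)) // size_polyX.
lia.
Qed.

(** * Stepanov's method *)

Lemma nterms_sum (F : nzRingType) (n : nat) (I : finType) (c : I -> F)
    (u : I -> nat) :
  (nterms F n (\sum_i c i *: 'X^(u i)) <= #|I|)%N.
Proof.
have nt0 : nterms F n 0 = 0%N.
  by apply: big1 => i _; rewrite coef0 eqxx.
have ntD P Q : (nterms F n (P + Q) <= nterms F n P + nterms F n Q)%N.
  rewrite -big_split; apply: leq_sum => i _ /=; rewrite coefD.
  case: (P`_i =P 0) => [->|_]; last by case: (_ != _).
  by rewrite add0r; case: (_ != _).
have nt1 i : (nterms F n (c i *: 'X^(u i)) <= 1)%N.
  rewrite /nterms (eq_bigr (fun j : 'I_n => ((j == u i :> nat) && (c i != 0))%R : nat)).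
    have [ltun|leun] := ltnP (u i) n; last first.
      rewrite big1 // => j _; suff -> : (j == u i :> nat) = false by [].
      by apply/negbTE; rewrite neq_ltn (leq_trans (ltn_ord j)).
    rewrite (bigD1 (Ordinal ltun)) //= eqxx big1 ?addn0; first by case: (c i != 0).
    by move=> j; rewrite -val_eqE /= => /negPf ->.
  move=> j _; rewrite coefZ coefXn.
  by case: (_ == _ :> nat); rewrite ?mulr1 ?mulr0 ?eqxx.
rewrite -sum1_card; elim/big_rec2: _ => [|i k P _ leP]; first by rewrite nt0.
by apply: leq_trans (ntD _ _) _; apply: leq_add.
Qed.

Lemma underdetermined (F : fieldType) (I J : finType) (a : I -> J -> F) :
  (#|J| < #|I|)%N ->
  exists2 c : I -> F, (exists i, c i != 0) & forall j, \sum_i c i * a i j = 0.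
Proof.
move=> ltJI; pose M := \matrix_(i < #|I|, j < #|J|) a (enum_val i) (enum_val j).
have kerM : kermx M != 0.
  rewrite kermx_eq0 /row_free neq_ltn.
  by rewrite (leq_ltn_trans (rank_leq_col M)).
pose v := nz_row (kermx M).
have v0 : v != 0 by rewrite nz_row_eq0.
have vM : v *m M = 0.
  by apply/sub_kermxP; apply: nz_row_sub.
exists (fun i => v 0 (enum_rank i)).
  have [i vi] : exists i, v 0 i != 0.
    apply/existsP; apply: contraR v0; rewrite negb_exists => /forallP v0.
    by apply/eqP/rowP => i; rewrite mxE; apply/eqP; rewrite -[_ == _]negbK.
  by exists (enum_val i); rewrite enum_valK.
move=> j; transitivity ((v *m M) 0 (enum_rank j)); last by rewrite vM mxE.
rewrite mxE (reindex (@enum_rank I)) /=; last first.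
  by exists enum_val => i _; rewrite ?enum_rankK ?enum_valK.
by apply: eq_bigr => i _; rewrite mxE !enum_rankK.
Qed.

Lemma iter_eulerd_sum (F : fieldType) (I : finType) (c : I -> F)
    (P : I -> {poly F}) (r : nat) :
  iter r (@eulerd F) (\sum_i c i *: P i) = \sum_i c i *: iter r (@eulerd F) (P i).
Proof.
elim: r => // r IHr; rewrite iterS IHr /eulerd raddf_sum mulr_sumr.
by apply: eq_bigr => i _; rewrite /= derivZ -scalerAr.
Qed.

Lemma card_mult_roots (F : finFieldType) (S : {set F}) (n : nat) (P : {poly F}) :
  P != 0 -> (forall x, x \in S -> ('X - x%:P) ^+ n %| P) ->
  (n * #|S| < size P)%N.
Proof.
move=> P0 dvdP.
have: (\prod_(x <- enum S) ('X - x%:P)) ^+ n %| P.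
  have: all [in S] (enum S) by apply/allP => x; rewrite mem_enum.
  elim: (enum S) (enum_uniq S) => [_ _|x s IHs /= /andP[xs us] /andP[xS sS]].
    by rewrite big_nil expr1n dvd1p.
  rewrite big_cons exprMn_comm; last exact: mulrC.
  rewrite Gauss_dvdp ?dvdP ?IHs //.
  rewrite coprimep_expl // coprimep_expr // coprimep_sym coprimep_XsubC.
  by rewrite root_prod_XsubC.
move=> /(dvdp_leq P0); apply: leq_trans.
have /eqP := size_exp (\prod_(x <- enum S) ('X - x%:P)) n.
rewrite size_prod_XsubC -cardE /= mulnC => /eqP <-.
rewrite ltn_predL lt0n size_poly_eq0 expf_neq0 //.
by rewrite monic_neq0 // monic_prod_XsubC.
Qed.

(** Stepanov's method.  The A B^2 coefficients of
    Psi = sum c_(k,i,j) X^i X^(t j) (1 - X)^(t k), i < A and j, k < B, are chosen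
    such that Psi vanishes to order A on S.  On the points with given values of
    x^t and (1 - x)^t, the r-th iterate of [eulerd] on Psi coincides with a
    polynomial of degree less than 2 A, so that 2 A conditions for each r < A
    and each value of the pair suffice.  The inequalities A B <= t and t B <= p
    make Psi nonzero by [sparse_independent], and its degree is less than
    3 t B. *)
Lemma stepanov (F : finFieldType) (p : nat) (charF : p \in [pchar F])
    (t A B : nat) (S : {set F}) :
  0 \notin S -> 1 \notin S -> (t * B <= p)%N -> (A * B <= t)%N ->
  (2 * #|[set (x ^+ t, (1 - x) ^+ t) | x in S]| * A < B ^ 2)%N ->
  (A * #|S| <= 3 * t * B)%N.
Proof.
move=> S0 S1 letBp leABt; set V := [set _ | x in S] => ltVB.
have B0 : (0 < B)%N by case: (B) ltVB.
have [->//|A0] := posnP A.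
have leAt : (A <= t)%N by apply: leq_trans leABt; rewrite leq_pmulr.
pose I := ('I_B * ('I_A * 'I_B))%type.
pose J := ('I_#|V| * 'I_A * 'I_(2 * A))%type.
pose q (i : I) (r : nat) := twist F (t * i.2.2) (t * i.1) i.2.1 r.
(* a i j is the coefficient of degree j.2 contributed by the i-th monomial to the
   j.1.2-th iterate of [eulerd], once x^t and (1 - x)^t have been replaced by
   their values on the j.1.1-th fibre *)
pose a (i : I) (j : J) :=
  (enum_val j.1.1).1 ^+ i.2.2 * (enum_val j.1.1).2 ^+ i.1 * (q i j.1.2)`_j.2.
have [|c [i0 ci0] cE] := @underdetermined F I J a.
  rewrite !card_prod !card_ord.
  have := ltVB; set s := #|V|.
  have -> : (s * A * (2 * A) = A * (2 * s * A))%N by ring.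
  have -> : (B * (A * B) = A * B ^ 2)%N by ring.
  by rewrite ltn_pmul2l.
pose mono (i : I) := 'X^(i.2.1) * 'X^(t * i.2.2) * (1 - 'X) ^+ (t * i.1) : {poly F}.
pose Psi := \sum_i c i *: mono i.
have Psi0 : Psi != 0.
  apply: contraNneq ci0 => Psi0.
  (* P k gathers the terms in (1 - X)^(t k); its exponents i + t j are distinct
     because A <= t *)
  pose P k := \sum_(i : 'I_A * 'I_B) c (k, i) *: 'X^(i.1 + t * i.2).
  have PsiE : Psi = \sum_(k < B) P k * (1 - 'X) ^+ (t * k).
    transitivity (\sum_k \sum_i c (k, i) *: mono (k, i)).
      by rewrite pair_bigA; apply: eq_bigr => -[].
    apply: eq_bigr => k _; rewrite mulr_suml; apply: eq_bigr => i _.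
    by rewrite /mono /= -scalerAl exprD.
  have := sparse_independent F p charF t B P _ _ (etrans (esym PsiE) Psi0).
  have szP k : (size (P k) <= p)%N.
    apply: leq_trans letBp; apply: (leq_trans (size_sum _ _ _)).
    apply/bigmax_leqP => i _; apply: leq_trans (size_scale_leq _ _) _.
    rewrite size_polyXn.
    apply: leq_trans (_ : t * i.2.+1 <= _)%N; last by rewrite leq_mul2l ltn_ord orbT.
    by rewrite mulnS -addSn leq_add2r (leq_trans (ltn_ord i.1)).
  have ntP k : (nterms F p (P k) <= t)%N.
    apply: leq_trans (nterms_sum _ _ _ _ _) _.
    by rewrite card_prod !card_ord.
  move=> /(_ szP ntP i0.1) /(congr1 (fun R : {poly F} => R`_(i0.2.1 + t * i0.2.2))).
  rewrite coef0 coef_sum (bigD1 i0.2) //= big1; last first.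
    move=> i nei; rewrite coefZ coefXn; case: eqP => [eqi|]; last by rewrite mulr0.
    case/eqP: nei; have := ltn_ord i.1; have := ltn_ord i0.2.1.
    move=> lt1 lt2; have e1 : i.1 = i0.2.1.
      apply/val_inj => /=; move/(congr1 (modn^~ t)): eqi.
      rewrite (addnC i.1) (addnC i0.2.1) !(mulnC t) !modnMDl.
      by rewrite !modn_small ?(leq_trans _ leAt).
    have e2 : i.2 = i0.2.2.
      apply/val_inj => /=; move: eqi; rewrite e1 => /addnI/eqP.
      by rewrite eqn_pmul2l ?(leq_trans A0) // => /eqP.
    by rewrite (surjective_pairing i) (surjective_pairing i0.2) e1 e2.
  by rewrite addr0 coefZ coefXn eqxx mulr1 -surjective_pairing => ->.
have szPsi : (size Psi <= 3 * t * B)%N.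
  apply: (leq_trans (size_sum _ _ _)); apply/bigmax_leqP => i _.
  apply: leq_trans (size_scale_leq _ _) _.
  have sz1X : (size (1 - 'X : {poly F})%R = 2)%N.
    by rewrite -opprB size_polyN -polyC1 size_XsubC.
  have sz1 : (size ((1 - 'X : {poly F}) ^+ (t * i.1)) = (t * i.1).+1)%N.
    have : (0 < size ((1 - 'X : {poly F}) ^+ (t * i.1)))%N.
      by rewrite size_poly_gt0 expf_neq0 // -size_poly_gt0 sz1X.
    have : (size ((1 - 'X : {poly F}) ^+ (t * i.1))).-1 = (t * i.1)%N.
      by rewrite size_exp sz1X mul1n.
    lia.
  rewrite /mono -exprD.
  apply: leq_trans (size_polyMleq _ _) _; rewrite sz1 size_polyXn.
  have le1 : (t * i.1 <= t * B.-1)%N by rewrite leq_mul2l -ltnS prednK // ltn_ord orbT.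
  have le2 : (t * i.2.2 <= t * B.-1)%N by rewrite leq_mul2l -ltnS prednK // ltn_ord orbT.
  have := ltn_ord i.2.1; have : (t * B = t * B.-1 + t)%N by rewrite -mulnSr prednK.
  rewrite -mulnA; move: leAt le1 le2.
  move: (t * i.1)%N (t * i.2.2)%N (t * B.-1)%N (t * B)%N (i.2.1 : nat).
  lia.
apply: leq_trans szPsi; apply/ltnW/card_mult_roots => // x xS.
have x0 : x != 0 by apply: contraNneq S0 => <-.
have x1 : x != 1 by apply: contraNneq S1 => <-.
have leAp : (A <= p)%N.
  by apply: leq_trans letBp; apply: leq_trans leAt _; rewrite leq_pmulr.
apply: (dvdp_exp_eulerd F p charF) => // r ltrA.
rewrite iter_eulerd_sum /root horner_sum.
have xV : (x ^+ t, (1 - x) ^+ t) \in V by apply: imset_f.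
transitivity (\sum_(n < 2 * A) x ^+ n * \sum_i c i *
   a i (enum_rank_in xV (x ^+ t, (1 - x) ^+ t), Ordinal ltrA, n) == 0).
  congr (_ == _).
  under [RHS]eq_bigr do rewrite mulr_sumr.
  rewrite exchange_big; apply: eq_bigr => i _ /=.
  rewrite hornerZ iter_eulerd_monomial !hornerE /a /= enum_rankK_in //=.
  rewrite (@horner_coef_wide _ (2 * A)); last first.
    apply: leq_trans (size_twist _ _ _ _ _) _.
    by rewrite mul2n -addnn leq_add // ltnW.
  rewrite mulr_sumr !mulr_suml; apply: eq_bigr => n _.
  by rewrite !exprM /q; ring.
by apply/eqP; rewrite big1 // => n _; rewrite cE mulr0.
Qed.

(** * Fibres of x |-> (x^t, (1 - x)^t) *)

Definition fiber (F : finFieldType) (t : nat) (x : F) : {set F} :=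
  [set y | (y ^+ t == x ^+ t) && ((1 - y) ^+ t == (1 - x) ^+ t)].

Definition rich (F : finFieldType) (t tau : nat) : {set F} :=
  [set x | [&& x != 0, x != 1 & (tau <= #|fiber F t x|)%N]].

Definition roots1 (F : finFieldType) (t : nat) : {set F} := [set u | u ^+ t == 1].

Lemma card_roots1 (F : finFieldType) (t : nat) :
  (0 < t)%N -> (#|roots1 F t| <= t)%N.
Proof.
move=> t0; rewrite cardE; apply: max_unity_roots => //; last exact: enum_uniq.
by apply/allP => x; rewrite mem_enum inE => xt; apply/unity_rootP/eqP.
Qed.

Lemma fiber_ratio (F : finFieldType) (t : nat) (x y : F) :
  x != 0 -> x != 1 -> y \in fiber F t x ->
  y / x \in roots1 F t /\ (1 - y) / (1 - x) \in roots1 F t.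
Proof.
move=> x0 x1; rewrite !inE => /andP[/eqP yx /eqP yx1].
have x1' : 1 - x != 0 by rewrite subr_eq0 eq_sym.
by rewrite !expr_div_n yx yx1 !divff ?expf_neq0.
Qed.

Lemma card_fiber_le (F : finFieldType) (t : nat) (x : F) :
  (0 < t)%N -> x != 0 -> x != 1 -> (#|fiber F t x| <= t)%N.
Proof.
move=> t0 x0 x1; apply: leq_trans (card_roots1 F t t0).
rewrite -(card_imset _ (divIf x0)); apply: subset_leq_card.
apply/fintype.subsetP => _ /imsetP[y yx ->].
by have [] := fiber_ratio F t x y x0 x1 yx.
Qed.

(** Two distinct points x, y of a fibre are recovered from the ratios y / x and
    (1 - y) / (1 - x), which are t-th roots of unity. *)
Lemma sum_fiber_pred (F : finFieldType) (t : nat) :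
  (0 < t)%N ->
  (\sum_(x : F | (x != 0)%R && (x != 1)%R) #|fiber F t x|.-1 <= t ^ 2)%N.
Proof.
move=> t0.
pose D := [set w : F * F | [&& w.1 != 0, w.1 != 1, w.2 != w.1 & w.2 \in fiber F t w.1]].
have -> : (\sum_(x : F | (x != 0)%R && (x != 1)%R) #|fiber F t x|.-1 = #|D|)%N.
  rewrite -sum1_card (eq_bigl (fun w : F * F => ((w.1 != 0) && (w.1 != 1)) &&
    ((w.2 != w.1) && (w.2 \in fiber F t w.1)))).
    rewrite -(pair_big_dep (fun x : F => (x != 0) && (x != 1))
      (fun x y => (y != x) && (y \in fiber F t x)) (fun _ _ => 1%N)) /=.
    apply: eq_bigr => x _; rewrite sum1_card.
    rewrite (cardD1 x (fiber F t x)) !inE !eqxx /=.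
    by apply: eq_card => y; rewrite !inE.
  by move=> w; rewrite inE -!andbA.
rewrite (_ : t ^ 2 = t * t)%N; last by rewrite expnS expn1.
apply: leq_trans (leq_mul (card_roots1 F t t0) (card_roots1 F t t0)).
rewrite -cardsX.
rewrite -(@card_in_imset _ _ (fun w : F * F => (w.2 / w.1, (1 - w.2) / (1 - w.1))) D).
  apply/subset_leq_card/fintype.subsetP => _ /imsetP[[x y] xyD ->].
  move: xyD; rewrite inE /= => /and4P[x0 x1 _ yx].
  by rewrite finset.in_setX /=; apply/andP; apply: fiber_ratio.
move=> [x y] [x' y']; rewrite !inE /=.
move=> /and4P[x0 x1 yx _] /and4P[x'0 x'1 yx' _] [].
set u := y / x; set v := (1 - y) / (1 - x) => eu ev.
have x1n : 1 - x != 0 by rewrite subr_eq0 eq_sym.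
have x1n' : 1 - x' != 0 by rewrite subr_eq0 eq_sym.
have yE : y = u * x by rewrite divfK.
have yE' : y' = u * x' by rewrite eu divfK.
have vE : 1 - u * x = v * (1 - x) by rewrite -yE divfK.
have vE' : 1 - u * x' = v * (1 - x') by rewrite -yE' ev divfK.
have key z : 1 - u * z = v * (1 - z) -> (v - u) * z = v - 1.
  move=> e; apply/eqP; rewrite -subr_eq0.
  have -> : (v - u) * z - (v - 1) = (1 - u * z) - v * (1 - z) by ring.
  by rewrite e subrr.
have uv : v - u != 0.
  apply: contraNneq yx => uv; move: (key x vE); rewrite uv mul0r => /esym/eqP.
  rewrite subr_eq0 => /eqP v1; move/eqP: uv; rewrite subr_eq0 v1 => /eqP u1.
  by rewrite yE -u1 mul1r.
have xx' : x = x' by apply: (mulfI uv); rewrite (key x vE) (key x' vE').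
by rewrite yE yE' xx'.
Qed.

(** The set of points on fibres of size at least tau is a union of fibres, so
    each of the pairs (x^t, (1 - x)^t) comes from at least tau of its points. *)
Lemma card_phi_rich (F : finFieldType) (t tau : nat) :
  (0 < t)%N ->
  (tau * #|[set (x ^+ t, (1 - x) ^+ t) | x in rich F t tau]| <= #|rich F t tau|)%N.
Proof.
move=> t0; set phi := fun x : F => (x ^+ t, (1 - x) ^+ t).
rewrite -[X in (_ <= X)%N]sum1_card.
rewrite (partition_big_imset phi) /= mulnC -sum_nat_const.
apply: leq_sum => _ /imsetP[x xr ->].
move: (xr); rewrite inE => /and3P[x0 x1 lex].
apply: (leq_trans lex); rewrite sum1_card; apply: subset_leq_card.
apply/fintype.subsetP => y; rewrite inE => /andP[/eqP yx /eqP yx1].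
rewrite unfold_in /= !xpair_eqE yx yx1 !eqxx !andbT inE.
have y0 : y != 0.
  by have := expf_neq0 t x0; rewrite -yx expf_eq0 t0.
have y1 : y != 1.
  have : (1 - x) ^+ t != 0 by rewrite expf_neq0 // subr_eq0 eq_sym.
  by rewrite -yx1 expf_eq0 t0 subr_eq0 eq_sym.
rewrite y0 y1 /=; apply: leq_trans lex _; apply: subset_leq_card.
by apply/fintype.subsetP => z; rewrite !inE yx yx1.
Qed.

(** Stepanov's method with B = t / A: the lower bound 2 A B >= t turns the
    condition on A into the one of [stepanov]. *)
Lemma rich_stepanov (F : finFieldType) (p : nat) (charF : p \in [pchar F])
    (t tau A : nat) :
  (t ^ 2 <= p)%N -> (0 < t)%N -> (0 < tau)%N -> (0 < A)%N ->
  (0 < #|rich F t tau|)%N ->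
  (8 * #|rich F t tau| * A ^ 3 < t ^ 2 * tau)%N ->
  (A ^ 2 * #|rich F t tau| <= 3 * t ^ 2)%N.
Proof.
move=> letp t0 tau0 A0 n0 ltA.
have := card_phi_rich F t tau t0.
have := stepanov F p charF t A (t %/ A) (rich F t tau).
set s := #|[set _ | x in _]|.
have len : (tau <= #|rich F t tau|)%N.
  have /card_gt0P[x xr] := n0.
  have s0 : (0 < s)%N by apply/card_gt0P; eexists; apply: imset_f xr.
  apply: leq_trans (card_phi_rich F t tau t0); exact: leq_pmulr.
move: len ltA; set n := #|rich F t tau| => len ltA stp les.
have ltA3 : (8 * A ^ 3 < t ^ 2)%N.
  rewrite -(ltn_pmul2l tau0); apply: leq_ltn_trans (_ : 8 * n * A ^ 3 < _)%N.
    by rewrite mulnCA mulnA leq_mul2r leq_mul2l len !orbT.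
  by rewrite [(tau * _)%N]mulnC.
have leAt : (A <= t)%N.
  rewrite leqNgt; apply/negP => ltta; move: ltA3; rewrite ltnNge expnS.
  by apply/negP/negPn; nia.
have leAB : (A * (t %/ A) <= t)%N by rewrite mulnC leq_trunc_div.
have ltAB : (t <= 2 * (A * (t %/ A)))%N.
  have B1 : (0 < t %/ A)%N by rewrite divn_gt0.
  have := ltn_ceil t A0; rewrite mulSn mulnC; nia.
move: stp leAB ltAB; move: (t %/ A)%N => B stp leAB ltAB.
have ltB : (2 * s * A < B ^ 2)%N.
  have : (4 * A ^ 2 * (2 * n * A) < 4 * A ^ 2 * (tau * B ^ 2))%N.
    have -> : (4 * A ^ 2 * (2 * n * A) = 8 * n * A ^ 3)%N by ring.
    apply: leq_trans ltA _.
    have -> : (4 * A ^ 2 * (tau * B ^ 2) = (2 * (A * B)) ^ 2 * tau)%N by ring.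
    by rewrite leq_mul2r leq_sqr ltAB orbT.
  rewrite ltn_pmul2l ?muln_gt0 ?expn_gt0 ?A0 // => ltn.
  rewrite -(ltn_pmul2l tau0); apply: leq_ltn_trans ltn.
  have -> : (tau * (2 * s * A) = tau * s * (2 * A))%N by ring.
  by have -> : (2 * n * A = n * (2 * A))%N by [ring]; rewrite leq_mul2r les orbT.
have leBt : (t * B <= p)%N.
  apply: leq_trans letp; rewrite expnS expn1 leq_mul2l.
  by rewrite (leq_trans _ leAB) ?orbT // leq_pmull.
have leAn : (A * n <= 3 * t * B)%N.
  by apply: stp => //; rewrite inE eqxx ?andbF.
rewrite expnS expn1 -mulnA; apply: leq_trans (_ : A * (3 * t * B) <= _)%N.
  by rewrite leq_mul2l leAn orbT.
have -> : (A * (3 * t * B) = 3 * t * (A * B))%N by ring.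
by rewrite expnS expn1 [X in (_ <= X)%N]mulnA leq_mul2l leAB orbT.
Qed.

(** The best A in [rich_stepanov] is the largest admissible one, of order
    (t^2 tau / n)^(1/3) where n is the number of points; it gives
    n tau^2 <= 3^3 64^2 t^2, and 3^3 64^2 = 48^3.  No A is admissible when
    t^2 tau <= 8 n; the bound n (tau - 1) <= t^2 of [sum_fiber_pred] then forces
    tau <= 3. *)
Lemma card_rich (F : finFieldType) (p : nat) (charF : p \in [pchar F])
    (t tau : nat) :
  (t ^ 2 <= p)%N -> (0 < t)%N -> (1 < tau)%N ->
  (#|rich F t tau| * tau ^ 2 <= 48 ^ 3 * t ^ 2)%N.
Proof.
move=> letp t0 tau1.
have := rich_stepanov F p charF t tau _ letp t0 (ltnW tau1).
have : (#|rich F t tau| * tau.-1 <= t ^ 2)%N.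
  apply: leq_trans (sum_fiber_pred F t t0).
  rewrite -sum_nat_const big_mkcond [X in (_ <= X)%N]big_mkcond.
  apply: leq_sum => x _; rewrite inE; case: (x != 0) => //; case: (x != 1) => //=.
  by case: ifP => // lex; rewrite -!subn1 leq_sub2r.
set n := #|rich F t tau| => lent stp.
have [->//|n0] := posnP n.
have [len|ltn] := leqP (t ^ 2 * tau) (8 * n * 1 ^ 3).
  have le8 : (t ^ 2 * (tau * tau.-1) <= t ^ 2 * 8)%N.
    rewrite exp1n muln1 in len.
    apply: leq_trans (_ : 8 * n * tau.-1 <= _)%N.
      by rewrite mulnA leq_mul2r len orbT.
    by rewrite -mulnA [X in (_ <= X)%N]mulnC leq_mul2l lent orbT.
  rewrite leq_pmul2l ?expn_gt0 ?t0 // in le8.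
  have le3 : (tau <= 3)%N by rewrite leqNgt; apply/negP => lt3; move: le8; nia.
  have len1 : (n <= t ^ 2)%N.
    apply: leq_trans lent.
    by rewrite leq_pmulr // -ltnS prednK ?(ltnW tau1).
  rewrite mulnC; apply: leq_mul => //.
  by apply: leq_trans (_ : 3 ^ 2 <= _)%N; rewrite // leq_sqr.
have bnd A : (8 * n * A ^ 3 < t ^ 2 * tau -> A <= t ^ 2 * tau)%N.
  have [->//|A0] := posnP A; move=> /ltnW; apply: leq_trans.
  have -> : (8 * n * A ^ 3 = A * (8 * n * A ^ 2))%N by ring.
  by rewrite leq_pmulr // !muln_gt0 n0 A0.
(* maximality of A bounds n A^3 from below, as A + 1 <= 2 A *)
have [A ltA maxA] := ex_maxnP (ex_intro (fun A => 8 * n * A ^ 3 < t ^ 2 * tau)%N 1%N ltn) bnd.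
have A0 : (0 < A)%N by exact: maxA.
have ltA1 : (t ^ 2 * tau <= 64 * (n * A ^ 3))%N.
  have : (t ^ 2 * tau <= 8 * n * A.+1 ^ 3)%N.
    by rewrite leqNgt; apply/negP => /maxA; rewrite ltnn.
  move/leq_trans; apply.
  have -> : (64 * (n * A ^ 3) = 8 * n * (2 * A) ^ 3)%N by ring.
  by rewrite leq_mul2l leq_exp2r //; apply/orP; right; lia.
have leA2 := stp A A0 n0 ltA.
have t40 : (0 < t ^ 4)%N by rewrite expn_gt0 t0.
rewrite -(leq_pmul2l t40).
have -> : (t ^ 4 * (n * tau ^ 2) = n * (t ^ 2 * tau) ^ 2)%N by ring.
apply: leq_trans (_ : n * (64 * (n * A ^ 3)) ^ 2 <= _)%N.
  by rewrite leq_mul2l leq_sqr ltA1 orbT.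
have -> : (n * (64 * (n * A ^ 3)) ^ 2 = 64 ^ 2 * (A ^ 2 * n) ^ 3)%N by ring.
apply: leq_trans (_ : 64 ^ 2 * (3 * t ^ 2) ^ 3 <= _)%N.
  by rewrite leq_mul2l leq_exp2r // leA2 orbT.
by apply/eq_leq; ring.
Qed.

(** * Multiplicative energy of shifted roots of unity *)

Definition slopes (F : finFieldType) (t : nat) (rho : F) : {set F * F} :=
  [set w | [&& w.1 \in roots1 F t, w.2 \in roots1 F t, w.1 != 1, w.2 != 1
             & 1 - w.1 == rho * (1 - w.2)]].

(** If 1 - u = rho (1 - v), then y = rho v / u satisfies
    1 - y = (1 - rho) / u, so y lies on the fibre of rho; it determines (u, v)
    and differs from rho since u <> 1. *)
Lemma card_slopes_le_fiber (F : finFieldType) (t : nat) (rho : F) :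
  (0 < t)%N -> rho != 0 -> rho != 1 ->
  (#|slopes F t rho| <= #|fiber F t rho|.-1)%N.
Proof.
move=> t0 rho0 rho1.
have rn : 1 - rho != 0 by rewrite subr_eq0 eq_sym.
have nz u : u \in roots1 F t -> u != 0.
  by rewrite inE; apply: contraTneq => ->; rewrite expr0n gtn_eqF // eq_sym oner_eq0.
have key u v : u != 0 -> 1 - u = rho * (1 - v) -> 1 - rho * v / u = (1 - rho) / u.
  move=> u0 e; apply: (mulIf u0); rewrite mulrBl !divfK // mul1r.
  apply/eqP; rewrite -subr_eq0.
  have -> : u - rho * v - (1 - rho) = rho * (1 - v) - (1 - u) by ring.
  by rewrite e subrr.
have -> : (#|fiber F t rho|.-1 = #|fiber F t rho :\ rho|)%N.
  by rewrite (cardsD1 rho (fiber F t rho)) inE !eqxx.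
rewrite -(@card_in_imset _ _ (fun w : F * F => rho * w.2 / w.1)).
  apply/subset_leq_card/fintype.subsetP => _ /imsetP[[u v] uvS ->].
  move: uvS; rewrite inE /= => /and5P[uG vG u1 v1 /eqP e].
  have u0 := nz u uG; rewrite !inE (key u v u0 e).
  have /eqP ut : u ^+ t == 1 by rewrite inE in uG.
  have /eqP vt : v ^+ t == 1 by rewrite inE in vG.
  rewrite !expr_div_n exprMn ut vt mulr1 !divr1 !eqxx !andbT.
  apply: contraNneq u1 => evu.
  have uv : u = v.
    by apply: (mulfI rho0); rewrite -[in LHS]evu divfK.
  have : (1 - rho) * (1 - u) = 0.
    by rewrite mulrBl mul1r {1}e -uv subrr.
  by move/eqP; rewrite mulf_eq0 (negPf rn) subr_eq0 eq_sym.
move=> [u v] [u' v']; rewrite !inE /=.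
move=> /and5P[uG vG _ _ /eqP e] /and5P[uG' vG' _ _ /eqP e'] ee.
have u0 : u != 0 by apply: nz; rewrite inE.
have u0' : u' != 0 by apply: nz; rewrite inE.
have uu' : u = u'.
  have := key _ _ u0 e; rewrite ee (key _ _ u0' e') => /(mulfI rn) /invr_inj.
  by move=> ->.
move: ee; rewrite uu' => /(divIf u0') /(mulfI rho0) -> //.
Qed.

Lemma layer_cake (n t : nat) :
  (n <= t)%N -> (n.-1 ^ 2 <= \sum_(2 <= k < t.+1 | k <= n) 2 * k)%N.
Proof.
have [->//|n0] := posnP n.
(* 2 k exceeds (k - 1)^2 - (k - 2)^2 *)
have lay m : (m.+1.-1 ^ 2 <= \sum_(2 <= k < m.+2) 2 * k)%N.
  elim: m => [|m IHm]; first by rewrite big_geq.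
  by rewrite big_nat_recr //=; apply: leq_trans (leq_add IHm (leqnn _)); lia.
move=> lent; have := lay n.-1; rewrite prednK // => /leq_trans; apply.
rewrite (big_cat_nat (n := n.+1) (p := t.+1)) //=.
apply: leq_trans (leq_addr _ _).
rewrite [X in (_ <= X)%N]big_nat_cond [X in (X <= _)%N]big_nat_cond.
by apply/eq_leq/eq_bigl => k; rewrite ltnS; lia.
Qed.

Lemma sum_slopes_sqr_le (F : finFieldType) (t : nat) :
  (0 < t)%N ->
  (\sum_(rho : F) #|slopes F t rho| ^ 2 <=
     t ^ 2 + \sum_(2 <= k < t.+1) 2 * k * #|rich F t k|)%N.
Proof.
move=> t0; rewrite (bigD1 0) //= (bigD1 1) ?oner_neq0 //=.
have -> : (#|slopes F t 0%R| ^ 2 = 0)%N.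
  have -> : #|slopes F t 0| = 0%N; last by [].
  apply: eq_card0 => -[u v]; rewrite !inE mul0r subr_eq0 /=.
  by rewrite [1 == u]eq_sym; case: (u == 1); rewrite ?andbF.
rewrite add0n; apply: leq_add.
  rewrite leq_sqr; apply: leq_trans (card_roots1 F t t0).
  rewrite -(@card_in_imset _ _ fst).
    apply/subset_leq_card/fintype.subsetP => _ /imsetP[[u v] uv ->].
    by move: uv; rewrite inE => /andP[].
  move=> [u v] [u' v']; rewrite !inE /= !mul1r.
  move=> /and5P[_ _ _ _ /eqP/addrI/oppr_inj <-].
  by move=> /and5P[_ _ _ _ /eqP/addrI/oppr_inj <-] ->.
apply: leq_trans (_ : \sum_(rho : F | (rho != 0)%R && (rho != 1)%R)
   \sum_(2 <= k < t.+1) (if (k <= #|fiber F t rho|)%N then 2 * k else 0) <= _)%N.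
  apply: leq_sum => rho /andP[rho0 rho1]; rewrite -big_mkcond /=.
  apply: leq_trans (layer_cake _ _ (card_fiber_le F t rho t0 rho0 rho1)).
  by rewrite leq_sqr card_slopes_le_fiber.
rewrite exchange_big /=; apply: leq_sum => k _.
rewrite -big_mkcondr /= sum_nat_const mulnC leq_mul2l; apply/orP; right.
apply: subset_leq_card; apply/fintype.subsetP => x.
by rewrite inE unfold_in => /andP[/andP[-> ->] ->].
Qed.

Lemma sum_inv_le_ln (R : realType) (t : nat) :
  (0 < t)%N -> \sum_(2 <= k < t.+1) k%:R^-1 <= ln t%:R :> R.
Proof.
case: t => // t _; elim: t => [|t IHt]; first by rewrite big_geq // ln1.
rewrite big_nat_recr //=; apply: le_trans (lerD IHt (lexx _)) _.
rewrite -lerBrDl -opprB -ln_div ?posrE ?ltr0n // lerNr.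
have -> : t.+1%:R / t.+2%:R = 1 + - (t.+2%:R)^-1 :> R.
  have t1 : 0 < t.+1%:R :> R by rewrite ltr0n.
  by rewrite -[t.+2%:R]natr1; move: t1; move: (t.+1%:R : R) => x x0; field; lra.
by apply: le_ln1Dx; rewrite ltrN2 invf_lt1 ?ltr0n // ltr1n.
Qed.

Lemma ln_ge_half (R : realType) (p : nat) : (1 < p)%N -> 2^-1 <= ln (p%:R : R).
Proof.
move=> p1; have : ln (1 + - 2^-1) <= - 2^-1 :> R by apply: le_ln1Dx; lra.
have -> : 1 + - 2^-1 = 2^-1 :> R by lra.
rewrite lnV ?posrE // lerN2 => /le_trans; apply.
by rewrite ler_ln ?posrE ?ltr0n ?ler_nat // ltnW.
Qed.

(** By [card_rich], the k-th term of [sum_slopes_sqr_le] is at most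
    2 48^3 t^2 / k, which sums to a logarithm; as 1 <= 2 ln p, the factor ln p
    also absorbs the t^2 coming from rho = 1. *)
Lemma shifted_energy_bound (R : realType) (F : finFieldType) (p : nat)
    (charF : p \in [pchar F]) (t : nat) :
  (0 < t)%N -> (t ^ 2 <= p)%N ->
  (\sum_(rho : F) #|slopes F t rho| ^ 2)%:R <=
    (2 + 2 * 48 ^+ 3) * t%:R ^+ 2 * ln p%:R :> R.
Proof.
move=> t0 letp; have p1 : (1 < p)%N := prime_gt1 (pcharf_prime charF).
have lnp := ln_ge_half R p p1.
have lntp : ln t%:R <= ln p%:R :> R.
  rewrite ler_ln ?posrE ?ltr0n ?(ltnW p1) // ler_nat.
  by apply: leq_trans letp; rewrite expnS expn1 leq_pmulr.
apply: le_trans (_ : (t ^ 2 + \sum_(2 <= k < t.+1) 2 * k * #|rich F t k|)%:R <= _).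
  by rewrite ler_nat sum_slopes_sqr_le.
rewrite natrD natrX natr_sum.
apply: le_trans (_ : t%:R ^+ 2 + \sum_(2 <= k < t.+1)
    2 * 48 ^+ 3 * t%:R ^+ 2 * k%:R^-1 <= _).
  rewrite lerD2l; apply: ler_sum_nat => k /andP[k2 _].
  have k0 : 0 < k%:R :> R by rewrite ltr0n ltnW.
  rewrite ler_pdivlMr // -!natrX -!natrM ler_nat.
  have := card_rich F p charF t k letp t0 k2; nia.
rewrite -mulr_sumr.
have := sum_inv_le_ln R t t0; set S := \sum_(_ <= _ < _) _ => leS.
have t20 : 0 <= t%:R ^+ 2 :> R by rewrite exprn_ge0.
have h1 : t%:R ^+ 2 * S <= t%:R ^+ 2 * ln p%:R.
  by rewrite ler_wpM2l // (le_trans leS).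
have h2 : t%:R ^+ 2 * 2^-1 <= t%:R ^+ 2 * ln p%:R :> R by rewrite ler_wpM2l.
have c0 : 0 <= 48 ^+ 3 :> R by rewrite exprn_ge0.
have h3 := ler_wpM2l c0 h1.
move: h2 h3; move: (48 ^+ 3 : R) (t%:R ^+ 2 : R) (ln p%:R) => c T L h2 h3.
lra.
Qed.

(** * Moment inequalities *)

Lemma cauchy_schwarz (C : numDomainType) (I : finType) (P : pred I)
    (a b : I -> C) :
  `|\sum_(i | P i) a i * b i| ^+ 2 <=
    (\sum_(i | P i) `|a i| ^+ 2) * (\sum_(i | P i) `|b i| ^+ 2).
Proof.
apply: le_trans (_ : (\sum_(i | P i) `|a i| * `|b i|) ^+ 2 <= _).
  rewrite ler_sqr ?nnegrE ?normr_ge0 ?sumr_ge0 // => [|i _].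
    by apply: le_trans (ler_norm_sum _ _ _) _; apply: ler_sum => i _; rewrite normrM.
  by rewrite mulr_ge0.
set SA := \sum_(i | P i) _ ^+ 2; set SB := \sum_(i | P i) _ ^+ 2.
set SM := \sum_(i | P i) _.
have : 0 <= \sum_(i | P i) \sum_(j | P j) (`|a i| * `|b j| - `|a j| * `|b i|) ^+ 2.
  apply: sumr_ge0 => i _; apply: sumr_ge0 => j _.
  by rewrite real_exprn_even_ge0 // rpredB // rpredM // normr_real.
(* Lagrange's identity *)
suff -> : \sum_(i | P i) \sum_(j | P j) (`|a i| * `|b j| - `|a j| * `|b i|) ^+ 2
    = (SA * SB - SM ^+ 2) *+ 2.
  by rewrite pmulrn_lge0 // subr_ge0.
transitivity (\sum_(i | P i) (`|a i| ^+ 2 * SB + `|b i| ^+ 2 * SA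
    - (`|a i| * `|b i| * SM) *+ 2)).
  apply: eq_bigr => i _; rewrite !mulr_sumr -sumrMnl -!big_split -sumrB /=.
  by apply: eq_bigr => j _; ring.
rewrite sumrB big_split /= sumrMnl -!mulr_suml -/SA -/SB -/SM; ring.
Qed.

Lemma sqr_norm_sum_le (C : numDomainType) (I : finType) (P : pred I) (a : I -> C) :
  `|\sum_(i | P i) a i| ^+ 2 <= #|P|%:R * \sum_(i | P i) `|a i| ^+ 2.
Proof.
have := cauchy_schwarz C I P (fun=> 1) a; under eq_bigr do rewrite mul1r.
rewrite normr1 expr1n (_ : \sum_(i | P i) 1 = #|P|%:R) // -sumr_const.
by apply: eq_bigl => i; rewrite unfold_in.
Qed.

(** A first Cauchy-Schwarz inequality over y removes beta, a second one over the
    pairs (z1, z2) removes alpha. *)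
Lemma bilinear_fourth_moment (C : numClosedFieldType) (Y Z : finType)
    (D : {set Y}) (E : {set Z}) (alpha : Z -> C) (beta : Y -> C)
    (k : Y -> Z -> C) :
  (forall z, `|alpha z| = 1) -> (forall y, `|beta y| = 1) ->
  `|\sum_(y in D) \sum_(z in E) alpha z * beta y * k y z| ^+ 4 <=
    #|D|%:R ^+ 2 * #|E|%:R ^+ 2 *
    \sum_(y1 in D) \sum_(y2 in D) \sum_(z1 in E) \sum_(z2 in E)
      k y1 z1 * (k y1 z2)^* * (k y2 z1)^* * k y2 z2.
Proof.
move=> alpha1 beta1.
set B := \sum_(y in D) _.
pose G z1 z2 := \sum_(y in D) k y z1 * (k y z2)^*.
have step1 : `|B| ^+ 2 <= #|D|%:R * \sum_(z1 in E) \sum_(z2 in E)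
    alpha z1 * (alpha z2)^* * G z1 z2.
  apply: le_trans (sqr_norm_sum_le _ _ _ _) _.
  rewrite ler_wpM2l ?ler0n // le_eqVlt; apply/orP; left; apply/eqP.
  transitivity (\sum_(y in D) \sum_(z1 in E) \sum_(z2 in E)
     alpha z1 * (alpha z2)^* * (k y z1 * (k y z2)^*)).
    apply: eq_bigr => y _.
    have -> : \sum_(z in E) alpha z * beta y * k y z
        = beta y * \sum_(z in E) alpha z * k y z.
      by rewrite mulr_sumr; apply: eq_bigr => z _; ring.
    rewrite normrM beta1 mul1r normCK rmorph_sum mulr_suml.
    apply: eq_bigr => z1 _; rewrite mulr_sumr; apply: eq_bigr => z2 _.
    by rewrite rmorphM /=; ring.
  rewrite exchange_big; apply: eq_bigr => z1 _.
  by rewrite exchange_big; apply: eq_bigr => z2 _; rewrite mulr_sumr.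
have -> : `|B| ^+ 4 = (`|B| ^+ 2) ^+ 2 by rewrite -exprM.
set V := \sum_(z1 in E) _ in step1.
have B2 : 0 <= `|B| ^+ 2 by rewrite exprn_ge0.
have D0 := le_trans B2 step1.
apply: le_trans (_ : (#|D|%:R * V) ^+ 2 <= _).
  by rewrite ler_sqr // nnegrE.
have -> : (#|D|%:R * V) ^+ 2 = #|D|%:R ^+ 2 * `|V| ^+ 2.
  by rewrite -[in LHS](ger0_norm D0) normrM exprMn normr_nat.
rewrite -mulrA ler_wpM2l ?exprn_ge0 ?ler0n //.
rewrite /V (pair_big (mem E) (mem E) (fun z1 z2 => alpha z1 * (alpha z2)^* * G z1 z2)) /=.
apply: le_trans (sqr_norm_sum_le _ _ _ _) _.
have -> : #|[pred p : Z * Z | (p.1 \in E) && (p.2 \in E)]|%:R = #|E|%:R ^+ 2 :> C.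
  rewrite -natrX; congr _%:R; rewrite expnS expn1 -cardsX.
  by apply: eq_card => w; rewrite !inE.
rewrite ler_wpM2l ?exprn_ge0 ?ler0n // le_eqVlt; apply/orP; left; apply/eqP.
transitivity (\sum_(z1 in E) \sum_(z2 in E) `|G z1 z2| ^+ 2).
  rewrite pair_big; apply: eq_bigr => w _.
  by rewrite !normrM alpha1 norm_conjC alpha1 !mul1r.
transitivity (\sum_(z1 in E) \sum_(z2 in E) \sum_(y1 in D) \sum_(y2 in D)
    k y1 z1 * (k y1 z2)^* * (k y2 z1)^* * k y2 z2).
  apply: eq_bigr => z1 _; apply: eq_bigr => z2 _.
  rewrite normCK rmorph_sum mulr_suml; apply: eq_bigr => y1 _.
  rewrite mulr_sumr; apply: eq_bigr => y2 _.
  by rewrite rmorphM /= conjCK; ring.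
pose T y1 y2 z1 z2 := k y1 z1 * (k y1 z2)^* * (k y2 z1)^* * k y2 z2.
transitivity (\sum_(z1 in E) \sum_(y1 in D) \sum_(z2 in E) \sum_(y2 in D)
    T y1 y2 z1 z2); first by apply: eq_bigr => z1 _; rewrite exchange_big.
rewrite exchange_big; apply: eq_bigr => y1 _.
transitivity (\sum_(z1 in E) \sum_(y2 in D) \sum_(z2 in E) T y1 y2 z1 z2).
  by apply: eq_bigr => z1 _; rewrite exchange_big.
by rewrite exchange_big.
Qed.

Lemma norm_sum_pow4_le (C : numDomainType) (I : finType) (a : I -> C) :
  `|\sum_i a i| ^+ 4 <= #|I|%:R ^+ 3 * \sum_i `|a i| ^+ 4.
Proof.
have -> : `|\sum_i a i| ^+ 4 = (`|\sum_i a i| ^+ 2) ^+ 2 by rewrite -exprM.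
apply: le_trans (_ : (#|I|%:R * \sum_i `|a i| ^+ 2) ^+ 2 <= _).
  have := sqr_norm_sum_le C I predT a; rewrite -[#|predT|]/#|I| => h.
  have h0 : 0 <= `|\sum_i a i| ^+ 2 by rewrite exprn_ge0.
  by rewrite ler_sqr // nnegrE (le_trans h0 h).
have := sqr_norm_sum_le C I predT (fun i => `|a i| ^+ 2).
rewrite -[#|predT|]/#|I| => h.
rewrite exprMn [_ ^+ 3]exprSr -mulrA.
rewrite ler_wpM2l ?exprn_ge0 //.
rewrite -[X in X ^+ 2]ger0_norm ?sumr_ge0 // => [|i _]; last by rewrite exprn_ge0.
apply: (le_trans h); rewrite ler_wpM2l // le_eqVlt; apply/orP; left; apply/eqP.
by apply: eq_bigr => i _; rewrite ger0_norm ?exprn_ge0 // -exprM.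
Qed.

(** * Power maps on units and additive characters *)

Lemma card_power_fiber (F : finFieldType) (D : {group {unit F}}) (m : nat) (u : F) :
  (#|[set y in D | val y ^+ m == u]| <= gcdn m #|D|)%N.
Proof.
have [->|[y0]] := set_0Vmem [set y in D | val y ^+ m == u]; first by rewrite cards0.
rewrite inE => /andP[y0D /eqP y0m].
have q0 : (0 < gcdn m #|D|)%N by rewrite gcdn_gt0 cardG_gt0 orbT.
apply: leq_trans (card_roots1 F _ q0).
rewrite -(@card_in_imset _ _ (fun y : {unit F} => val (y0^-1 * y)%g)); last first.
  by move=> y y' _ _ /val_inj /mulgI.
apply/subset_leq_card/fintype.subsetP => _ /imsetP[y + ->].
rewrite inE => /andP[yD /eqP ym]; rewrite inE.
have zD : (y0^-1 * y)%g \in D by rewrite groupM ?groupV.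
have zm : ((y0^-1 * y) ^+ m = 1)%g.
  apply: val_inj; rewrite FinRing.val_unitX FinRing.val_unitM FinRing.val_unitV.
  rewrite exprMn exprVn y0m ym mulVf // -y0m expf_neq0 //.
  by rewrite -unitfE (valP y0).
rewrite -FinRing.val_unitX; apply/eqP; rewrite -[RHS](FinRing.val_unit1 F).
congr val; apply/eqP; rewrite -order_dvdn dvdn_gcd !order_dvdn zm eqxx /=.
by rewrite expg_cardG.
Qed.

Lemma exists_subgroup_card (F : finFieldType) (d : nat) :
  (d %| #|F|.-1)%N ->
  exists2 D : {group {unit F}}, #|D| = d & forall y, y \in D -> val y ^+ d = 1.
Proof.
move=> dN; have /cyclicP[x defU] := field_unit_group_cyclic [set: {unit F}]%G.
have ox : #[x]%g = #|F|.-1 by rewrite orderE -defU card_finField_unit.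
have N0 : (0 < #|F|.-1)%N by rewrite -ox order_gt0.
have d0 := dvdn_gt0 N0 dN.
exists (<[x ^+ (#|F|.-1 %/ d)]>)%G => [|y].
  rewrite -orderE orderXdiv ox ?divn_dvd //; last by rewrite dvdn_div.
  by rewrite divnA // mulKn.
have od : #[x ^+ (#|F|.-1 %/ d)]%g = d.
  by rewrite orderXdiv ox ?dvdn_div // divnA // mulKn.
move=> /order_dvdG; rewrite -orderE od order_dvdn => /eqP yd.
by rewrite -FinRing.val_unitX yd FinRing.val_unit1.
Qed.

(** On a group of order d, the map y |-> y^m takes its values among the
    (d / gcd(m, d))-th roots of unity and has fibres of size at most
    gcd(m, d). *)
Lemma sum_power_le (C : numDomainType) (F : finFieldType)
    (D : {group {unit F}}) (m : nat) (w : F -> C) :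
  (forall u, 0 <= w u) ->
  \sum_(y in D) w (val y ^+ m) <=
    (gcdn m #|D|)%:R * \sum_(u in roots1 F (#|D| %/ gcdn m #|D|)) w u.
Proof.
move=> w0; set q := gcdn m #|D|.
rewrite (partition_big (fun y : {unit F} => val y ^+ m)
  [in roots1 F (#|D| %/ q)]) /=; last first.
  move=> y yD; rewrite inE -exprM.
  have -> : (m * (#|D| %/ q) = #|D| * (m %/ q))%N.
    by rewrite !muln_divCA_gcd mulnC /q.
  by rewrite exprM -FinRing.val_unitX expg_cardG // FinRing.val_unit1 expr1n.
rewrite mulr_sumr; apply: ler_sum => u _.
rewrite (eq_bigr (fun=> w u)) => [|y /andP[_ /eqP->]//].
have -> : \sum_(y in D | val y ^+ m == u) w u
    = w u *+ #|[set y in D | val y ^+ m == u]|.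
  by rewrite -sumr_const; apply: eq_bigl => y; rewrite inE.
by rewrite -[X in X <= _]mulr_natl ler_wpM2r // ler_nat card_power_fiber.
Qed.

Definition additive_char (F : finFieldType) (C : numClosedFieldType)
    (psi : F -> C) : Prop :=
  [/\ forall u v, psi (u + v) = psi u * psi v, forall u, `|psi u| = 1
    & exists w, psi w != 1].

Definition power_sum (F : finFieldType) (C : numClosedFieldType)
    (psi : F -> C) (c : F) (m : nat) (t : F) : C :=
  \sum_(x : {unit F}) psi (c * val x ^+ m * t).

Lemma additive_char0 (F : finFieldType) (C : numClosedFieldType) (psi : F -> C) :
  additive_char F C psi -> psi 0 = 1.
Proof.
case=> psiD psi1 _; have p0 : psi 0 != 0 by rewrite -normr_eq0 psi1 oner_eq0.
by apply: (mulfI p0); rewrite -psiD addr0 mulr1.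
Qed.

Lemma additive_char_conj (F : finFieldType) (C : numClosedFieldType)
    (psi : F -> C) (u : F) :
  additive_char F C psi -> (psi u)^* = psi (- u).
Proof.
move=> psiP; have [psiD psi1 _] := psiP.
have pu : psi u != 0 by rewrite -normr_eq0 psi1 oner_eq0.
apply: (mulfI pu); rewrite -normCK psi1 expr1n -psiD subrr.
by rewrite (additive_char0 F C).
Qed.

Lemma sum_additive_char (F : finFieldType) (C : numClosedFieldType)
    (psi : F -> C) (u : F) :
  additive_char F C psi ->
  \sum_(t : F) psi (t * u) = if u == 0 then #|F|%:R else 0.
Proof.
move=> psiP; have [psiD psi1 [w psiw]] := psiP.
case: eqVneq => [->|u0].
  under eq_bigr do rewrite mulr0 (additive_char0 F C psi psiP).
  by rewrite sumr_const.
transitivity (\sum_t psi t); first by rewrite [RHS](reindex_inj (mulIf u0)).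
have : \sum_t psi t = psi w * \sum_t psi t.
  rewrite mulr_sumr [LHS](reindex_inj (addrI w)).
  by apply: eq_bigr => t _; rewrite psiD.
move/eqP; rewrite -subr_eq0 -{1}[\sum_t psi t]mul1r -mulrBl mulf_eq0.
by rewrite subr_eq0 eq_sym (negPf psiw) => /eqP.
Qed.

Lemma power_sum_dilate (F : finFieldType) (C : numClosedFieldType)
    (psi : F -> C) (c : F) (m : nat) (u : {unit F}) (t : F) :
  power_sum F C psi c m (val u ^+ m * t) = power_sum F C psi c m t.
Proof.
rewrite [RHS](reindex_inj (mulIg u)); apply: eq_bigr => x _.
by rewrite FinRing.val_unitM exprMn !mulrA.
Qed.

Lemma power_sum_norm_le (F : finFieldType) (C : numClosedFieldType)
    (psi : F -> C) (c : F) (m : nat) (t : F) :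
  additive_char F C psi -> `|power_sum F C psi c m t| <= #|F|%:R.
Proof.
case=> _ psi1 _; apply: le_trans (ler_norm_sum _ _ _) _.
under eq_bigr do rewrite psi1.
rewrite sumr_const ler_nat.
by rewrite -cardsT card_finField_unit leq_pred.
Qed.

(** By orthogonality, the left-hand side is #|F| times the number of pairs of
    units with equal m-th powers. *)
Lemma power_sum_second_moment (F : finFieldType) (C : numClosedFieldType)
    (psi : F -> C) (c : F) (m : nat) :
  additive_char F C psi -> c != 0 ->
  \sum_(t : F) `|power_sum F C psi c m t| ^+ 2 <=
    #|F|%:R ^+ 2 * (gcdn m #|F|.-1)%:R.
Proof.
move=> psiP c0; have [psiD psi1 _] := psiP.
have -> : \sum_(t : F) `|power_sum F C psi c m t| ^+ 2 =
    \sum_(x : {unit F}) \sum_(y : {unit F})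
      \sum_(t : F) psi (t * (c * (val x ^+ m - val y ^+ m))).
  under [RHS]eq_bigr do rewrite exchange_big.
  rewrite [RHS]exchange_big; apply: eq_bigr => t _ /=.
  rewrite normCK rmorph_sum mulr_suml; apply: eq_bigr => x _.
  rewrite mulr_sumr; apply: eq_bigr => y _.
  by rewrite /= (additive_char_conj F C psi _ psiP) -psiD; congr psi; ring.
apply: le_trans (_ : \sum_(x : {unit F}) #|F|%:R * (gcdn m #|F|.-1)%:R <= _).
  apply: ler_sum => x _.
  under eq_bigr => y _ do rewrite (sum_additive_char F C psi _ psiP).
  rewrite -big_mkcond /= sumr_const -[X in X <= _]mulr_natr.
  rewrite ler_wpM2l ?ler0n // ler_nat.
  have := card_power_fiber F [set: {unit F}]%G m (val x ^+ m).
  rewrite card_finField_unit; apply: leq_trans; apply: subset_leq_card.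
  apply/fintype.subsetP => y yE; rewrite !inE /=.
  have : c * (val x ^+ m - val y ^+ m) == 0 := yE.
  by rewrite mulf_eq0 (negPf c0) /= subr_eq0 eq_sym.
rewrite sumr_const -[X in X <= _]mulr_natl mulrA expr2.
rewrite !ler_wpM2r ?ler0n // ler_nat.
by rewrite -cardsT card_finField_unit leq_pred.
Qed.

(** * Trinomial sums *)

(** Both weights disappear by [bilinear_fourth_moment], applied for each fixed x.
    The resulting power sums at (y1^m - y2^m)(z1^m - z2^m) only depend on
    the ratios y2 / y1 and z2 / z1, by [power_sum_dilate]. *)
Lemma trilinear_pow4_le (F : finFieldType) (C : numClosedFieldType)
    (psi : F -> C) (c : F) (m : nat) (D E : {group {unit F}})
    (alpha beta : {unit F} -> {unit F} -> C) :
  additive_char F C psi ->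
  (forall x z, `|alpha x z| = 1) -> (forall x y, `|beta x y| = 1) ->
  `|\sum_(x : {unit F}) \sum_(y in D) \sum_(z in E)
      alpha x z * beta x y * psi (c * (val x * val y * val z) ^+ m)| ^+ 4 <=
  #|F|%:R ^+ 3 * (#|D|%:R * #|E|%:R) ^+ 3 *
    \sum_(y in D) \sum_(z in E)
      `|power_sum F C psi c m ((1 - val y ^+ m) * (1 - val z ^+ m))|.
Proof.
move=> psiP alpha1 beta1; have [psiD _ _] := psiP.
pose Phi := power_sum F C psi c m.
pose kk (x y z : {unit F}) := psi (c * (val x * val y * val z) ^+ m).
pose W := \sum_(y1 in D) \sum_(y2 in D) \sum_(z1 in E) \sum_(z2 in E)
  Phi ((val y1 ^+ m - val y2 ^+ m) * (val z1 ^+ m - val z2 ^+ m)).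
have leN : #|{: {unit F}}|%:R <= #|F|%:R :> C.
  by rewrite ler_nat -cardsT card_finField_unit leq_pred.
have leW : `|\sum_(x : {unit F}) \sum_(y in D) \sum_(z in E)
    alpha x z * beta x y * kk x y z| ^+ 4
    <= #|{: {unit F}}|%:R ^+ 3 * (#|D|%:R ^+ 2 * #|E|%:R ^+ 2 * W).
  apply: le_trans (norm_sum_pow4_le C _ _) _.
  rewrite ler_wpM2l ?exprn_ge0 ?ler0n //.
  apply: le_trans (ler_sum _ (fun x _ => bilinear_fourth_moment C _ _ D E
    (alpha x) (beta x) (kk x) (alpha1 x) (beta1 x))) _.
  rewrite -mulr_sumr le_eqVlt; apply/orP; left; apply/eqP; congr (_ * _).
  rewrite exchange_big; apply: eq_bigr => y1 _.
  rewrite exchange_big; apply: eq_bigr => y2 _.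
  rewrite exchange_big; apply: eq_bigr => z1 _.
  rewrite exchange_big; apply: eq_bigr => z2 _.
  apply: eq_bigr => x _; rewrite /kk !(additive_char_conj F C psi _ psiP).
  by rewrite -!psiD; congr psi; rewrite !exprMn; ring.
have W_le : `|W| <= #|D|%:R * #|E|%:R * \sum_(y in D) \sum_(z in E)
    `|Phi ((1 - val y ^+ m) * (1 - val z ^+ m))|.
  apply: le_trans (ler_norm_sum _ _ _) _.
  rewrite -mulrA mulr_natl -sumr_const; apply: ler_sum => y1 y1D.
  apply: le_trans (ler_norm_sum _ _ _) _.
  rewrite (reindex_inj (mulgI y1)).
  rewrite (eq_bigl [in D]) => [|y]; last by rewrite groupMl.
  rewrite mulr_sumr; apply: ler_sum => y yD.
  apply: le_trans (ler_norm_sum _ _ _) _.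
  rewrite mulr_natl -sumr_const; apply: ler_sum => z1 z1E.
  apply: le_trans (ler_norm_sum _ _ _) _.
  rewrite (reindex_inj (mulgI z1)).
  rewrite (eq_bigl [in E]) => [|z]; last by rewrite groupMl.
  apply: ler_sum => z zE; rewrite !FinRing.val_unitM !exprMn.
  have <- : val (y1 * z1)%g ^+ m * ((1 - val y ^+ m) * (1 - val z ^+ m)) =
      (val y1 ^+ m - val y1 ^+ m * val y ^+ m) *
      (val z1 ^+ m - val z1 ^+ m * val z ^+ m).
    by rewrite FinRing.val_unitM exprMn; ring.
  by rewrite /Phi power_sum_dilate.
have W0 : 0 <= #|{: {unit F}}|%:R ^+ 3 * (#|D|%:R ^+ 2 * #|E|%:R ^+ 2 * W).
  by apply: le_trans leW; rewrite exprn_ge0.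
apply: (le_trans leW); rewrite -[X in X <= _]ger0_norm //.
pose de : C := #|D|%:R * #|E|%:R.
have de0 : 0 <= de by rewrite mulr_ge0.
have -> : #|{: {unit F}}|%:R ^+ 3 * (#|D|%:R ^+ 2 * #|E|%:R ^+ 2 * W)
    = #|{: {unit F}}|%:R ^+ 3 * de ^+ 2 * W by rewrite /de; ring.
rewrite normrM ger0_norm; last by rewrite mulr_ge0 ?exprn_ge0.
rewrite -/de -[power_sum F C psi c m]/Phi.
apply: le_trans (_ : #|F|%:R ^+ 3 * de ^+ 2 * `|W| <= _).
  by rewrite !ler_wpM2r ?exprn_ge0 // lerXn2r ?nnegrE ?ler0n.
set Sum := \sum_(y in D) _ in W_le *.
have -> : #|F|%:R ^+ 3 * de ^+ 3 * Sum = #|F|%:R ^+ 3 * de ^+ 2 * (de * Sum) by ring.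
by rewrite ler_wpM2l // mulr_ge0 ?exprn_ge0 ?ler0n.
Qed.

Definition products (F : finFieldType) (g h : nat) (t : F) : {set F * F} :=
  [set w | [&& w.1 \in roots1 F g, w.2 \in roots1 F h, w.1 != 1, w.2 != 1
             & (1 - w.1) * (1 - w.2) == t]].

(** The equation (1 - u)(1 - v) = (1 - u')(1 - v') <> 0 says that
    rho = (1 - u) / (1 - u') equals (1 - v') / (1 - v), so its solutions are
    classified by rho. *)
Lemma sum_products_sqr_le (F : finFieldType) (g h : nat) :
  (\sum_(t : F) #|products F g h t| ^ 2 <=
   \sum_(rho : F) #|slopes F g rho| * #|slopes F h rho|)%N.
Proof.
pose prod (w : F * F) := (1 - w.1) * (1 - w.2).
pose Q := [set q : (F * F) * (F * F) |
  (q.1 \in products F g h (prod q.1)) && (q.2 \in products F g h (prod q.1))].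
have -> : (\sum_(t : F) #|products F g h t| ^ 2 = #|Q|)%N.
  rewrite -[RHS]sum1_card.
  rewrite [RHS](partition_big (fun q => prod q.1) predT) //=.
  apply: eq_bigr => t _; rewrite expnS expn1 -cardsX -sum1_card.
  apply: eq_bigl => -[w w']; rewrite !inE /= /prod.
  have [->|ne] := eqVneq ((1 - w.1) * (1 - w.2)) t.
    by rewrite !eqxx !andbT.
  by rewrite !andbF.
rewrite -sum1_card.
rewrite (partition_big (fun q => (1 - q.1.1) / (1 - q.2.1)) predT) //=.
apply: leq_sum => rho _; rewrite sum1dep_card -cardsX.
pose sw (q : (F * F) * (F * F)) := ((q.1.1, q.2.1), (q.2.2, q.1.2)).
have sw_inj : injective sw.
  by move=> [[u v] [u' v']] [[x y] [x' y']] [-> -> -> ->].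
rewrite -(card_imset _ sw_inj); apply/subset_leq_card/fintype.subsetP.
move=> _ /imsetP[[[u v] [u' v']] + ->]; rewrite !inE /= /prod !eqxx !andbT.
move=> /andP[/andP[/and4P[uG vH u1 v1] /and5P[uG' vH' u1' v1' /eqP e]] /eqP <-].
rewrite uG vH u1 v1 uG' vH' u1' v1' /=.
have n1 x : x != 1 -> 1 - x != 0 :> F by rewrite subr_eq0 eq_sym.
rewrite divfK ?n1 // eqxx /=; apply/eqP; apply: (mulfI (n1 _ u1')).
by rewrite e mulrA mulrCA mulfV ?n1 // mulr1.
Qed.

(** M (g + h) accounts for u = 1 or v = 1, and V is the sum over the remaining
    pairs. *)
Lemma sum_shifted_products_le (F : finFieldType) (C : numClosedFieldType)
    (g h : nat) (w : F -> C) (M : C) :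
  (0 < g)%N -> (0 < h)%N -> (forall t, 0 <= w t <= M) ->
  exists2 V : C, \sum_(u in roots1 F g) \sum_(v in roots1 F h)
      w ((1 - u) * (1 - v)) <= M * (g + h)%:R + V &
    0 <= V /\ V ^+ 2 <= (\sum_(rho : F) #|slopes F g rho| * #|slopes F h rho|)%:R *
      \sum_(t : F) w t ^+ 2.
Proof.
move=> g0 h0 wP.
have w0 t : 0 <= w t by have /andP[] := wP t.
have wM t : w t <= M by have /andP[] := wP t.
have M0 : 0 <= M := le_trans (w0 0) (wM 0).
pose A := [pred p : F * F | [&& p.1 \in roots1 F g, p.2 \in roots1 F h, p.1 != 1 & p.2 != 1]].
exists (\sum_(p | A p) w ((1 - p.1) * (1 - p.2))); last first.
  split; first by apply: sumr_ge0.
  have -> : \sum_(p | A p) w ((1 - p.1) * (1 - p.2)) =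
      \sum_t #|products F g h t|%:R * w t.
    rewrite (partition_big (fun p : F * F => (1 - p.1) * (1 - p.2)) predT) //=.
    apply: eq_bigr => t _; rewrite mulr_natl -sumr_const.
    apply: eq_big => [p|p /andP[_ /eqP->] //].
    by rewrite /products -!andbA [RHS]inE.
  have := cauchy_schwarz C F predT (fun t => #|products F g h t|%:R) w.
  rewrite ger0_norm; last by apply: sumr_ge0 => t _; rewrite mulr_ge0.
  move/le_trans; apply.
  rewrite (eq_bigr (fun t => (#|products F g h t| ^ 2)%:R)) => [|t _]; last first.
    by rewrite normr_nat natrX.
  rewrite -natr_sum [X in _ * X <= _](eq_bigr (fun t => w t ^+ 2)) => [|t _]; last first.
    by rewrite ger0_norm.
  rewrite ler_wpM2r ?ler_nat ?sum_products_sqr_le //.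
  by apply: sumr_ge0 => t _; rewrite exprn_ge0.
rewrite pair_big /=.
apply: le_trans (_ : \sum_(p : F * F) (
   (if (p.1 \in [set 1]) && (p.2 \in roots1 F h) then M else 0) +
   (if (p.1 \in roots1 F g) && (p.2 \in [set 1]) then M else 0) +
   (if A p then w ((1 - p.1) * (1 - p.2)) else 0)) <= _).
  rewrite big_mkcond; apply: ler_sum => -[u v] _ /=; rewrite !inE.
  have := wM ((1 - u) * (1 - v)); have := w0 ((1 - u) * (1 - v)).
  move: (w _) => x x0 xM.
  case: (u ^+ g == 1); case: (v ^+ h == 1); case: (u == 1); case: (v == 1);
    rewrite /= ?add0r ?addr0 ?addr_ge0 //.
  by rewrite (le_trans xM) // lerDl.
rewrite !big_split /= -!big_mkcond lerD2r natrD mulrDr addrC.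
have cardM (P : {set F}) (Q : {set F}) n : (#|P| * #|Q| <= n)%N ->
    \sum_(p | (p.1 \in P) && (p.2 \in Q)) M <= M * n%:R.
  move=> le_n; rewrite (eq_bigl [in finset.setX P Q]) => [|p]; last by rewrite inE.
  by rewrite sumr_const cardsX -[X in X <= _]mulr_natr ler_wpM2l // ler_nat.
apply: lerD; apply: cardM; rewrite cards1 ?muln1 ?mul1n; exact: card_roots1.
Qed.

(** Averaging over the subgroups of orders d and e, on which x^k and x^l are
    trivial, leads to [trilinear_pow4_le].  Passing from the groups to the roots
    of unity by [sum_power_le] trades 1/(d e) for 1/(g h).  The bound for the
    fourth power has two terms; the eighth power separates them by
    (x + y)^2 <= 2 (x^2 + y^2). *)
Lemma trinomial_sum_pow8_le (F : finFieldType) (C : numClosedFieldType)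
    (psi : F -> C) (chi : {unit F} -> C) (a b c : F) (k l m d e g h : nat) :
  additive_char F C psi -> c != 0 ->
  (forall x y, chi (x * y)%g = chi x * chi y) -> (forall x, `|chi x| = 1) ->
  (d %| k)%N -> (d %| #|F|.-1)%N -> (e %| l)%N -> (e %| #|F|.-1)%N ->
  d = (g * gcdn m d)%N -> e = (h * gcdn m e)%N ->
  `|\sum_(x : {unit F}) chi x *
      psi (a * val x ^+ k + b * val x ^+ l + c * val x ^+ m)| ^+ 8
    * (g%:R * h%:R) ^+ 2 <=
  2 * #|F|%:R ^+ 8 * ((g + h)%:R ^+ 2 +
    (\sum_(rho : F) #|slopes F g rho| * #|slopes F h rho|)%:R *
    (gcdn m #|F|.-1)%:R).
Proof.
move=> psiP c0 chiM chi1 dk dN el eN dE eE.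
have [psiD psi1 _] := psiP.
have [D cD D1] := exists_subgroup_card F d dN.
have [E cE E1] := exists_subgroup_card F e eN.
have d0 : (0 < d)%N by rewrite -cD cardG_gt0.
have e0 : (0 < e)%N by rewrite -cE cardG_gt0.
set S := \sum_x _.
set qd := gcdn m d in dE; set qe := gcdn m e in eE.
have qd0 : (0 < qd)%N by rewrite gcdn_gt0 d0 orbT.
have qe0 : (0 < qe)%N by rewrite gcdn_gt0 e0 orbT.
have gE : g = (d %/ qd)%N by rewrite {1}dE mulnK.
have hE : h = (e %/ qe)%N by rewrite {1}eE mulnK.
have g0 : (0 < g)%N by move: d0; rewrite dE muln_gt0 => /andP[].
have h0 : (0 < h)%N by move: e0; rewrite eE muln_gt0 => /andP[].
pose alpha (x z : {unit F}) := chi x * chi z * psi (a * (val x * val z) ^+ k).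
pose beta (x y : {unit F}) := chi y * psi (b * (val x * val y) ^+ l).
have SE : S * (d%:R * e%:R) = \sum_(x : {unit F}) \sum_(y in D) \sum_(z in E)
      alpha x z * beta x y * psi (c * (val x * val y * val z) ^+ m).
  rewrite exchange_big /= [S * _]mulrCA mulr_natl -cD -sumr_const.
  apply: eq_bigr => y yD; rewrite exchange_big /= mulrC mulr_natl -cE -sumr_const.
  apply: eq_bigr => z zE; rewrite /S (reindex_inj (mulIg (y * z)%g)).
  apply: eq_bigr => x _; rewrite !chiM !FinRing.val_unitM.
  have yk : val y ^+ k = 1 by case/dvdnP: dk => n ->; rewrite mulnC exprM D1 ?expr1n.
  have zl : val z ^+ l = 1 by case/dvdnP: el => n ->; rewrite mulnC exprM E1 ?expr1n.
  rewrite /alpha /beta !psiD !exprMn yk zl mul1r !mulr1 !mulrA; ring.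
have Q0 : 0 < #|F|%:R :> C by rewrite ltr0n; apply/card_gt0P; exists 0.
pose w t := `|power_sum F C psi c m t|.
have wP t : 0 <= w t <= #|F|%:R by rewrite normr_ge0 power_sum_norm_le.
have w0 t : 0 <= w t by rewrite normr_ge0.
have [V leV [V0 V2]] := sum_shifted_products_le F C g h w #|F|%:R g0 h0 wP.
have le4 : `|S| ^+ 4 * (g%:R * h%:R) <= #|F|%:R ^+ 3 * (#|F|%:R * (g + h)%:R + V).
  have de3 : 0 < (d%:R * e%:R) ^+ 3 * (qd%:R * qe%:R) :> C.
    by rewrite !(mulr_gt0, exprn_gt0) ?ltr0n.
  rewrite -(ler_pM2r de3).
  have -> : `|S| ^+ 4 * (g%:R * h%:R) * ((d%:R * e%:R) ^+ 3 * (qd%:R * qe%:R))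
      = `|S * (d%:R * e%:R)| ^+ 4.
    have -> : `|S * (d%:R * e%:R)| = `|S| * (d%:R * e%:R).
      by rewrite normrM [`|d%:R * _|]normrM !normr_nat.
    have deE : d%:R * e%:R = (g%:R * h%:R) * (qd%:R * qe%:R) :> C.
      by rewrite {1}dE {1}eE !natrM; ring.
    by rewrite [RHS]exprMn [(d%:R * e%:R) ^+ 4]exprSr {3}deE; ring.
  rewrite SE; apply: le_trans (trilinear_pow4_le F C psi c m D E _ _ psiP _ _) _.
  - by move=> x z; rewrite /alpha !normrM !chi1 psi1 !mulr1.
  - by move=> x y; rewrite /beta !normrM !chi1 psi1 !mulr1.
  rewrite cD cE.
  have -> : #|F|%:R ^+ 3 * (#|F|%:R * (g + h)%:R + V) *
      ((d%:R * e%:R) ^+ 3 * (qd%:R * qe%:R)) =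
      #|F|%:R ^+ 3 * (d%:R * e%:R) ^+ 3 *
      (qd%:R * (qe%:R * (#|F|%:R * (g + h)%:R + V))) by ring.
  rewrite ler_wpM2l //; first by rewrite !(mulr_ge0, exprn_ge0) ?ler0n.
  apply: le_trans (_ : \sum_(y in D) qe%:R * \sum_(v in roots1 F h)
      w ((1 - val y ^+ m) * (1 - v)) <= _).
    apply: ler_sum => y _.
    have := sum_power_le C F E m (fun v => w ((1 - val y ^+ m) * (1 - v))) (fun=> w0 _).
    by rewrite cE -/qe -hE.
  rewrite -mulr_sumr.
  have := sum_power_le C F D m (fun u => \sum_(v in roots1 F h) w ((1 - u) * (1 - v)))
    (fun u => sumr_ge0 _ (fun v _ => w0 _)).
  rewrite cD -/qd -gE => le_u.
  rewrite mulrCA ler_wpM2l ?ler0n // (le_trans le_u) //.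
  by rewrite ler_wpM2l ?ler0n.
have l0 : 0 <= `|S| ^+ 4 * (g%:R * h%:R).
  by rewrite !mulr_ge0 ?exprn_ge0 ?ler0n.
have -> : `|S| ^+ 8 * (g%:R * h%:R) ^+ 2 = (`|S| ^+ 4 * (g%:R * h%:R)) ^+ 2.
  by rewrite [RHS]exprMn -exprM.
have r0 := le_trans l0 le4.
apply: le_trans (_ : (#|F|%:R ^+ 3 * (#|F|%:R * (g + h)%:R + V)) ^+ 2 <= _).
  by rewrite ler_sqr ?nnegrE.
have moment := power_sum_second_moment F C psi c m psiP c0.
set X := (\sum_rho _)%N in V2 *.
set G := (g + h)%:R in r0 *; set Q := #|F|%:R in Q0 r0 moment *.
set f := (gcdn m _)%:R in moment *.
have V2' : V ^+ 2 <= X%:R * (Q ^+ 2 * f) by apply: (le_trans V2); rewrite ler_wpM2l ?ler0n.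
apply: le_trans (_ : 2 * Q ^+ 6 * (Q ^+ 2 * G ^+ 2 + V ^+ 2) <= _).
  rewrite -subr_ge0.
  have -> : 2 * Q ^+ 6 * (Q ^+ 2 * G ^+ 2 + V ^+ 2) - (Q ^+ 3 * (Q * G + V)) ^+ 2
     = Q ^+ 6 * (Q * G - V) ^+ 2 by ring.
  apply: mulr_ge0; first by rewrite exprn_ge0 // ltW.
  rewrite real_exprn_even_ge0 //.
  by rewrite rpredB ?ger0_real // mulr_ge0 ?ler0n // ltW.
have -> : 2 * Q ^+ 8 * (G ^+ 2 + X%:R * f) =
   2 * Q ^+ 6 * (Q ^+ 2 * G ^+ 2 + X%:R * (Q ^+ 2 * f)) by ring.
by rewrite ler_wpM2l ?lerD2l // mulr_ge0 ?exprn_ge0 ?ler0n // ltW.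
Qed.

(** * Complex characters of the prime field *)

Local Open Scope complex_scope.

Lemma expiD (R : realType) (s t : R) : expi (s + t) = expi s * expi t.
Proof.
by apply/eqP; rewrite eq_complex /= cosD sinD eqxx /= addrC.
Qed.

Lemma expi_norm (R : realType) (t : R) : `|expi t| = 1.
Proof. by rewrite normc_def /= cos2Dsin2 sqrtr1. Qed.

Lemma expi_2pin (R : realType) (t : R) (n : nat) :
  expi (t + 2 * pi * n%:R) = expi t.
Proof.
have -> : 2 * pi * n%:R = pi *+ 2 *+ n :> R by rewrite -mulr_natr [pi *+ 2]mulr2n; ring.
by rewrite /expi (periodicn (@cosD2pi R)) (periodicn (@sinD2pi R)).
Qed.

(** Nontriviality: cos(2 pi / p) = 1 - 2 sin(pi / p)^2 < 1. *)
Lemma e_p_additive_char (R : realType) (p : nat) :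
  prime p -> additive_char 'F_p R[i] (@e_p R p).
Proof.
move=> pr; have p0 : (p%:R : R) != 0 by rewrite pnatr_eq0 -lt0n prime_gt0.
have Fp : (Zp_trunc (pdiv p)).+2 = p := Fp_cast pr.
split=> [u v|u|]; last 1 first.
- exists 1; rewrite eq_complex /= negb_and; apply/orP; left.
  rewrite Fp modn_small ?prime_gt1 //.
  have pR : 1 < p%:R :> R by rewrite ltr1n prime_gt1.
  have -> : 2 * pi * 1%:R / p%:R = (pi / p%:R) *+ 2 :> R.
    by rewrite mulr1 mulr2n; field.
  have s0 : 0 < sin (pi / p%:R) :> R.
    apply: sin_gt0_pi; rewrite divr_gt0 ?pi_gt0 ?(lt_trans ltr01) //=.
    by rewrite ltr_pdivrMr ?(lt_trans ltr01) // ltr_pMr ?pi_gt0.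
  rewrite cos_mulr2n; have := cos2Dsin2 (pi / p%:R : R).
  have := exprn_gt0 2 s0; rewrite lt_neqAle mulr2n => /andP[_] h1 h2.
  by rewrite neq_lt; apply/orP; left; have := exprn_gt0 2 s0; lra.
- rewrite /e_p -expiD.
  have -> : nat_of_ord (u + v) = ((u + v) %% p)%N by exact: (congr1 (modn (u + v)%N) Fp).
  rewrite -(expi_2pin _ _ ((u + v) %/ p)); congr expi.
  have E : (u : nat)%:R + (v : nat)%:R =
      ((u + v) %/ p)%:R * p%:R + ((u + v) %% p)%:R :> R.
    by rewrite -natrD [in LHS](divn_eq (u + v) p) natrD natrM.
  by rewrite -mulrDl -[in RHS]mulrDr E; field.
- exact: expi_norm.
Qed.

Lemma mult_char_norm (R : realType) (p : nat) (chi : {unit 'F_p} -> R[i])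
    (x : {unit 'F_p}) : mult_char chi -> `|chi x| = 1.
Proof.
move=> [chi1 chiM].
have chiX n : chi (x ^+ n)%g = chi x ^+ n.
  by elim: n => [|n IHn]; rewrite ?expg0 ?expr0 // expgS exprS chiM IHn.
have := chiX #|[set: {unit 'F_p}]|; rewrite expg_cardG ?inE // chi1.
move/(congr1 Num.norm); rewrite normr1 normrX => /esym/eqP.
by rewrite pexpr_eq1 ?cardG_gt0 // => /eqP.
Qed.

Lemma slopes_correlation_bound (R : realType) (p g h : nat) :
  prime p -> (0 < g)%N -> (0 < h)%N -> (g ^ 2 <= p)%N -> (h ^ 2 <= p)%N ->
  (\sum_(rho : 'F_p) #|slopes 'F_p g rho| * #|slopes 'F_p h rho|)%:R <=
    (2 + 2 * 48 ^+ 3) * g%:R * h%:R * ln p%:R :> R.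
Proof.
move=> pr g0 h0 leg leh; set K : R := 2 + _.
have K0 : 0 <= K by rewrite addr_ge0 // mulr_ge0 // exprn_ge0.
have L0 : 0 <= ln p%:R :> R by rewrite ln_ge0 // ler1n prime_gt0.
rewrite -ler_sqr ?nnegrE ?ler0n // ?mulr_ge0 //.
have := cauchy_schwarz R 'F_p predT (fun rho => #|slopes 'F_p g rho|%:R)
   (fun rho => #|slopes 'F_p h rho|%:R).
under eq_bigr do rewrite -natrM.
rewrite -natr_sum normr_nat => /le_trans; apply.
have sq t : \sum_(rho : 'F_p) `|#|slopes 'F_p t rho|%:R : R| ^+ 2 =
    (\sum_(rho : 'F_p) #|slopes 'F_p t rho| ^ 2)%:R.
  by rewrite natr_sum; apply: eq_bigr => rho _; rewrite normr_nat natrX.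
rewrite !sq.
have -> : (K * g%:R * h%:R * ln p%:R) ^+ 2 =
  (K * g%:R ^+ 2 * ln p%:R) * (K * h%:R ^+ 2 * ln p%:R) by ring.
by apply: ler_pM => //; apply: shifted_energy_bound => //; apply: pchar_Fp.
Qed.

Lemma quotient_mul_dvdn (d f n : nat) :
  (0 < d)%N -> (d %| n)%N -> (f %| n)%N -> (d %/ gcdn d f * f %| n)%N.
Proof.
move=> d0 dn fn; have q0 : (0 < gcdn d f)%N by rewrite gcdn_gt0 d0.
suff -> : (d %/ gcdn d f * f = lcmn d f)%N by rewrite dvdn_lcm dn.
by rewrite -(mulnK (lcmn d f) q0) muln_lcm_gcd divn_mulAC ?dvdn_gcdl.
Qed.

(** The point is that p - 1 < p ln p, which is the strict inequality 1 + x < exp x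
    at x = - ln p. *)
Lemma sqr_lt_xlnx (R : realType) (p n : nat) :
  (1 < p)%N -> (n ^ 2 < p)%N -> n%:R < (p%:R * ln p%:R) `^ (1 / 2) :> R.
Proof.
move=> p1 np; have p0 : 0 < p%:R :> R by rewrite ltr0n ltnW.
have lnp0 : 0 < ln p%:R :> R by rewrite ln_gt0 // ltr1n.
have key : p%:R - 1 < p%:R * ln p%:R :> R.
  have : 1 - ln p%:R < p%:R^-1 :> R.
    by rewrite -[X in _ < X^-1]lnK ?posrE // -expRN expR_gt1Dx // oppr_eq0 gt_eqF.
  by rewrite -(ltr_pM2l p0) mulfV ?gt_eqF //; lra.
have n2 : n%:R ^+ 2 <= p%:R - 1 :> R.
  by rewrite lerBrDr -natrX natr1 ler_nat.
rewrite div1r powR12_sqrt; last by rewrite mulr_ge0 // ltW.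
rewrite -[X in X < _]ger0_norm ?ler0n // -sqrtr_sqr ltr_sqrt; first exact: le_lt_trans key.
by rewrite mulr_gt0.
Qed.

Lemma powR_eighth (R : realType) (x : R) : 0 <= x -> (x `^ (1 / 8)) ^+ 8 = x.
Proof.
move=> x0; rewrite -powR_mulrn ?powR_ge0 // -powRrM.
by have -> : 1 / 8 * 8%:R = 1 :> R; [field | rewrite powRr1].
Qed.

Theorem theorem1p5 (R : realType) :
  exists2 C : R, 0 < C &
  forall (p : nat) (k l m : nat) (a b c : 'F_p) (chi : {unit 'F_p} -> R[i]),
    prime p ->
    (0 < k)%N -> (0 < l)%N -> (0 < m)%N ->
    k <> l -> k <> m -> l <> m ->
    a != 0 -> b != 0 -> c != 0 ->
    mult_char chi ->
    let Psi : {poly 'F_p} := a *: 'X^k + b *: 'X^l + c *: 'X^m in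
    let d := gcdn k p.-1 in
    let e := gcdn l p.-1 in
    let f := gcdn m p.-1 in
    let g := (d %/ gcdn d f)%N in
    let h := (e %/ gcdn e f)%N in
    let P : R := p%:R in
    let F : R := f%:R in
    let G : R := g%:R in
    let H : R := h%:R in
    let T : R := (P * ln P) `^ (1 / 2) in
    (h <= g)%N -> (g <= f)%N ->
    [/\ T <= H ->
          `|char_sum chi Psi| <= (C * (P `^ (7 / 8) * F `^ (1 / 8)))%:C,
        H < T -> T <= G ->
          `|char_sum chi Psi| <=
            (C * (P `^ (15 / 16) * (F / H) `^ (1 / 8) * (ln P) `^ (1 / 16)))%:C
      & G < T ->
          `|char_sum chi Psi| <=
            (C * (P * (F / (G * H)) `^ (1 / 8) * (ln P) `^ (1 / 8)))%:C].
Proof.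
pose K : R := 2 + 2 * 48 ^+ 3.
have K0 : 0 <= K by rewrite addr_ge0 // mulr_ge0 // exprn_ge0.
(* the 8 pays for the terms with u = 1 or v = 1, through
   (g + h)^2 <= 4 g^2 <= 4 f g h <= 8 f g h ln p *)
pose C : R := 2 * (8 + K).
have CE : C = 2 * (8 + K) by [].
have C1 : 1 <= C by rewrite CE; lra.
clearbody C.
exists C; first exact: lt_le_trans C1.
move=> p k l m a b c chi pr k0 l0 m0 _ _ _ _ _ c0 chiP Psi d e f g h P F G H T hg gf.
have p1 := prime_gt1 pr; have p0 := prime_gt0 pr.
have p10 : (0 < p.-1)%N by rewrite -ltnS prednK.
have dp : (d %| p.-1)%N by exact: dvdn_gcdr.
have ep : (e %| p.-1)%N by exact: dvdn_gcdr.
have fp : (f %| p.-1)%N by exact: dvdn_gcdr.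
have d0 : (0 < d)%N by rewrite gcdn_gt0 k0.
have e0 : (0 < e)%N by rewrite gcdn_gt0 l0.
have f0 : (0 < f)%N by rewrite gcdn_gt0 m0.
have g0 : (0 < g)%N by rewrite divn_gt0 ?gcdn_gt0 ?d0 // dvdn_leq // dvdn_gcdl.
have h0 : (0 < h)%N by rewrite divn_gt0 ?gcdn_gt0 ?e0 // dvdn_leq // dvdn_gcdl.
have g2p : (g ^ 2 < p)%N.
  rewrite -[p in (_ < p)%N]prednK // ltnS.
  apply: leq_trans (dvdn_leq p10 (quotient_mul_dvdn d f _ d0 dp fp)).
  by rewrite expnS expn1 leq_mul2l gf orbT.
have h2p : (h ^ 2 < p)%N by apply: leq_ltn_trans g2p; rewrite leq_sqr.
have GT : G < T by apply: sqr_lt_xlnx.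
have HT : H < T by apply: sqr_lt_xlnx.
(* T exceeds both G and H, so the first two ranges are empty *)
split=> [|_|_]; [by rewrite leNgt HT | by rewrite leNgt GT |].
have gcd_m n : (n %| p.-1)%N -> gcdn n f = gcdn m n.
  by move=> np; rewrite /f gcdnC -gcdnA (gcdnC p.-1) (gcdn_idPl np).
have dE : d = (g * gcdn m d)%N by rewrite -(gcd_m d dp) divnK // dvdn_gcdl.
have eE : e = (h * gcdn m e)%N by rewrite -(gcd_m e ep) divnK // dvdn_gcdl.
have cardF : #|'F_p| = p := card_Fp pr.
have := trinomial_sum_pow8_le 'F_p R[i] (@e_p R p) chi a b c k l m d e g h
  (e_p_additive_char R p pr) c0 (proj2 chiP)
  (fun x => mult_char_norm R p chi x chiP) (dvdn_gcdl _ _).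
rewrite cardF => /(_ dp (dvdn_gcdl _ _) ep dE eE).
rewrite -/f.
have -> : \sum_(x : {unit 'F_p}) chi x *
    e_p R (a * val x ^+ k + b * val x ^+ l + c * val x ^+ m) = char_sum chi Psi.
  by apply: eq_bigr => x _; rewrite !hornerE.
set X := (\sum_rho _)%N.
have leX : X%:R <= K * G * H * ln P :=
  slopes_correlation_bound R p g h pr g0 h0 (ltnW g2p) (ltnW h2p).
rewrite normc_def; set r : R := Num.sqrt _.
have r0 : 0 <= r by exact: sqrtr_ge0.
move=> le8C.
have {le8C} le8 : r ^+ 8 * (G * H) ^+ 2 <= 2 * P ^+ 8 * ((G + H) ^+ 2 + X%:R * F).
  have natC n : (n%:R : R)%:C = n%:R by rewrite rmorph_nat.
  rewrite -natrD -lecR rmorphM !rmorphXn rmorphM 2!rmorphM rmorphXn [X in _ <= _ * X]rmorphD.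
  by rewrite rmorphXn rmorphM /= !natC.
have lnP2 : 2^-1 <= ln P := ln_ge_half R p p1.
have P0 : 0 < P by rewrite ltr0n.
have G0 : 0 < G by rewrite ltr0n.
have H0 : 0 < H by rewrite ltr0n.
have F0 : 0 < F by rewrite ltr0n.
have H1 : 1 <= H by rewrite ler1n.
have L0 : 0 < ln P by apply: lt_le_trans lnP2; rewrite invr_gt0.
have HG : H <= G by rewrite ler_nat.
have GF : G <= F by rewrite ler_nat.
rewrite lecR -(@ler_pXn2r _ 8) ?nnegrE //; last first.
  apply: mulr_ge0; first exact: le_trans C1.
  by rewrite !mulr_ge0 ?powR_ge0 ?(ltW P0).
have GH0 : 0 < G * H by rewrite mulr_gt0.
have GH2 : 0 < (G * H) ^+ 2 by rewrite exprn_gt0.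
have FGH : 0 <= F / (G * H) by rewrite ltW // divr_gt0.
rewrite !exprMn (powR_eighth R _ FGH) (powR_eighth R _ (ltW L0)).
rewrite -(ler_pM2r GH2); apply: (le_trans le8).
have -> : C ^+ 8 * (P ^+ 8 * (F / (G * H)) * ln P) * (G * H) ^+ 2 =
   P ^+ 8 * (C ^+ 8 * (F * (G * H) * ln P)) by field; rewrite !gt_eqF.
have -> : 2 * P ^+ 8 * ((G + H) ^+ 2 + X%:R * F) =
   P ^+ 8 * (2 * ((G + H) ^+ 2 + X%:R * F)) by ring.
rewrite ler_wpM2l ?exprn_ge0 ?(ltW P0) //.
apply: le_trans (_ : C * (F * (G * H) * ln P) <= _); last first.
  by rewrite ler_wpM2r ?ler_eXnr // !mulr_ge0 ?ltW.
have b1 : (G + H) ^+ 2 <= 8 * (F * (G * H) * ln P).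
  apply: le_trans (_ : 4 * (G * G) <= _); first by nra.
  have : G * G <= F * (G * H).
    by rewrite mulrCA ler_wpM2l ?(ltW G0) // (le_trans GF) // ler_peMr // ltW.
  have : F * (G * H) * 2^-1 <= F * (G * H) * ln P.
    by rewrite ler_wpM2l // !mulr_ge0 // ltW.
  lra.
have b2 : X%:R * F <= K * (F * (G * H) * ln P).
  have -> : K * (F * (G * H) * ln P) = (K * G * H * ln P) * F by ring.
  by rewrite ler_wpM2r // ltW.
rewrite CE; lra.
Qed.
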